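(* Let $(T,v^* )$ be an even finite rooted tree, and let $M$ be a positive integer. Let $\phi:V(T)\to\mathbb{Z}$ be a uniformly random $M$-Lipschitz function satisfying $\phi\equiv0$ on the leaves of $T$. Let $R$ be the effective resistance between the root and the leaves of $T$. Then the following hold: (a) $|\phi(v^* )|$ is stochastically dominated by $M+1+\left|\mathcal{N}_{\mathbb{Z}}\left(0,(2M+1)^2R\right)\right|$; (b) $\mathrm{Var}(\phi(v^* ))\le(4M+2)^2(R+1)$.
   Context: An integer-valued $M$-Lipschitz function on a graph $G$ is a function $\phi:V(G)\to\mathbb{Z}$ with $|\phi(u)-\phi(v)|\le M$ for every edge $(u,v)$. In a rooted tree, the leaves are the vertices with no children. A rooted tree is even if every leaf is at even distance from the root. The effective resistance is computed in the electrical network in which every edge of $T$ has resistance $1$ and all leaves are identified to a single node. $\mathcal{N}_{\mathbb{Z}}(0,\sigma^2)$ denotes a discrete Gaussian random variable taking value $x\in\mathbb{Z}$ with probability proportional to $e^{-x^2/(2\sigma^2)}$. $X$ is stochastically dominated by $Y$ if $\mathbb{P}(X\ge t)\le\mathbb{P}(Y\ge t)$ for all $t$. *)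

(* Defs.v *)
From HB Require Import structures.
From mathcomp Require Import all_boot all_order all_algebra.
From mathcomp Require Import all_classical all_reals all_analysis.

Set Implicit Arguments.
Unset Strict Implicit.
Unset Printing Implicit Defensive.

Import Order.TTheory GRing.Theory Num.Theory.
Local Open Scope classical_set_scope.
Local Open Scope ring_scope.

Section Trees.
Variable V : finType.
Implicit Types (e : rel V) (root u v : V).

(* A finite tree: a simple graph that is connected and has no cycle.  In
   mathcomp a [ucycle] of length 2 is just an edge traversed back and forth. *)
Definition is_tree e : Prop :=
  [/\ symmetric e, irreflexive e, (forall u v, connect e u v)
    & forall c : seq V, ucycle e c -> (size c <= 2)%N].

(* Least length of a walk from u to v ([#|V|] if there is none). *)
Definition distance e u v : nat :=
  find (fun n => [exists p : n.-tuple V, path e u p && (last u p == v)])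
       (iota 0 #|V|).

(* u is a child of v in the tree e rooted at root *)
Definition child e root v u : bool :=
  e v u && (distance e root u == (distance e root v).+1).

Definition leaf e root v : bool := [forall u, ~~ child e root v u].

Definition even_tree e root : Prop :=
  forall v, leaf e root v -> ~~ odd (distance e root v).

Definition M_lipschitz e (M : nat) (f : {ffun V -> int}) : Prop :=
  forall u v, e u v -> `|f u - f v| <= M%:Z.

Definition lipschitz_zero_on_leaves e root (M : nat) : set {ffun V -> int} :=
  [set f | M_lipschitz e M f /\ (forall v, leaf e root v -> f v = 0)].

End Trees.

Section Networks.
Variable R : realType.

(* Effective resistance between a and z in the electrical network on V with
   symmetric conductances c: the potential difference h a - h z when a unit
   current enters at a and leaves at z (Kirchhoff's node law combined with
   Ohm's law). *)
Definition effective_resistance (V : finType) (c : V -> V -> R) (a z : V) : R :=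
  xget 0 [set r | exists2 h : V -> R,
    (forall x, \sum_y c x y * (h x - h y) = (x == a)%:R - (x == z)%:R)
    & r = h a - h z].

(* The vertices in A are identified to the node None; conductances of parallel
   edges add up.  The nodes Some x with x in A become isolated. *)
Definition identify_node (V : finType) (A : pred V) (x : V) : option V :=
  if A x then None else Some x.

Definition identify (V : finType) (A : pred V) (c : V -> V -> R) :
    option V -> option V -> R :=
  fun i j => \sum_(x | identify_node A x == i)
             \sum_(y | identify_node A y == j) c x y.

Definition tree_resistance (V : finType) (e : rel V) (root : V) : R :=
  effective_resistance (identify (leaf e root) (fun x y => (e x y)%:R))
    (identify_node (leaf e root) root) None.

End Networks.

Section Laws.
Variable R : realType.

(* The normalizing constant k is forced by P being a probability
   (S is meant to be countable). *)
Definition law_proportional_to d (Omega : measurableType d)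
    (P : probability Omega R) (S : Type) (X : Omega -> S) (w : S -> R) : Prop :=
  (forall s, measurable [set o | X o = s]) /\
  exists k : R, forall s, P [set o | X o = s] = (k * w s)%:E.

Definition uniform_on d (Omega : measurableType d) (P : probability Omega R)
    (S : Type) (X : Omega -> S) (A : set S) : Prop :=
  law_proportional_to P X (\1_A : S -> R).

(* For zero variance the discrete Gaussian is the constant 0, as usual. *)
Definition discrete_gaussian_weight (s2 : R) (x : int) : R :=
  if s2 == 0 then (x == 0)%:R else expR (- (x%:~R ^+ 2) / (2 * s2)).

Definition discrete_gaussian d (Omega : measurableType d)
    (P : probability Omega R) (N : Omega -> int) (s2 : R) : Prop :=
  law_proportional_to P N (discrete_gaussian_weight s2).

Definition stochastically_dominated d (Omega : measurableType d)
    (P : probability Omega R) (X : Omega -> R)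
    d' (Omega' : measurableType d') (P' : probability Omega' R)
    (Y : Omega' -> R) : Prop :=
  forall t : R, (P [set o | (t <= X o)%R] <= P' [set o | (t <= Y o)%R])%E.

End Laws.

(* Main.v *)
Require Import Defs.
From HB Require Import structures.
From mathcomp Require Import all_boot all_order all_algebra.
From mathcomp Require Import all_classical all_reals all_analysis.
From mathcomp Require Import measurable_realfun.
From mathcomp Require Import zify ring lra.

Set Implicit Arguments.
Unset Strict Implicit.
Unset Printing Implicit Defensive.

Import Order.TTheory GRing.Theory Num.Theory.
Local Open Scope ring_scope.

(* Let f_v(x) count the M-Lipschitz functions on the subtree of v that vanish on
   its leaves and take the value x at v.  It is the product over the children c
   of v of the sums of f_c over the windows [x - M, x + M] of length K = 2M + 1.
   Let C_v be the effective conductance from v to the leaves of its subtree.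
   By induction from the leaves, f_v is even and, for x >= 0,
     f_v(x + 1) <= exp (- C_v (x - M)_+ / K^2) f_v(x).
   Products add the rates C, as conductances in parallel do.  Summation over a
   window turns the rate C into C / (1 + C), as a unit resistance in series
   does: the rates on the window of x = M + z are indexed by z, ..., z + 2M, and
   the shift by M makes them average to z.
   At the root this compares |phi(root)| - (M + 1) term by term with a discrete
   Gaussian of variance K^2 R, which gives (a); summation by parts of the same
   inequality gives (b). *)

(** * Elementary bounds on exponentials and hyperbolic functions *)

Section ExponentialBounds.
Variable R : realType.
Implicit Types a b c d u x y z : R.

Lemma expRN_le_inv u : 0 <= u -> expR (- u) <= (1 + u)^-1.
Proof.
move=> u0; rewrite expRN lef_pV2 ?posrE ?expR_gt0 ?expR_ge1Dx //; lra.
Qed.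

Lemma expR_le_inv u : u < 1 -> expR u <= (1 - u)^-1.
Proof.
move=> u1; rewrite -[u]opprK expRN lef_pV2 ?posrE ?expR_gt0 ?opprK //.
  exact: expR_ge1Dx.
by rewrite subr_gt0.
Qed.

(** A weak form of [tanh b <= b]: the constant 3/2 leaves enough slack to use only
    [1 + u <= expR u], and it makes the case [b >= 2/3] trivial. *)
Lemma expR_sub_le b : 0 <= b ->
  expR b - expR (- b) <= 3 / 2 * b * (expR b + expR (- b)).
Proof.
move=> b0; have p1 := expR_gt0 b; have p2 := expR_gt0 (- b).
have [hb|hb] := leP (2 / 3) b; first by nra.
have e1 : expR b * expR (- b) = 1 by rewrite -expRD subrr expR0.
have e2 : expR b * (1 - b) <= 1.
  by rewrite -ler_pdivlMr ?mul1r ?expR_le_inv //; lra.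
have e3 : 1 - b <= expR (- b) by have := expR_ge1Dx (- b); lra.
(* multiplying by [expR (- b)] reduces to [expR (- b) ^+ 2 >= (1 - b) ^+ 2] *)
suff : 0 <= expR b * ((1 + 3 / 2 * b) * expR (- b) ^+ 2 - (1 - 3 / 2 * b)).
  have -> : expR b * ((1 + 3 / 2 * b) * expR (- b) ^+ 2 - (1 - 3 / 2 * b)) =
    (1 + 3 / 2 * b) * expR (- b) * (expR b * expR (- b))
     - expR b * (1 - 3 / 2 * b) by ring.
  by rewrite e1; lra.
apply: mulr_ge0; first exact: ltW.
have : (1 - b) ^+ 2 <= expR (- b) ^+ 2 by rewrite lerXn2r ?nnegrE //; lra.
nra.
Qed.

(** Apply the addition formula for cosh, with [cosh d <= 1 + 64/63 d ^ 2], [sinh d <= 15/14 d],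
    [sinh b <= 3/2 b cosh b] and [1 + u <= expR u]. The exponent is [(b + d) ^ 2 - b ^ 2], twice
    what [tanh x <= x] would give; this pays for the crude constants. *)
Lemma cosh_shift_le b d : 0 <= d -> d <= 1 / 8 -> d <= 2 * b ->
  expR (b + d) + expR (- (b + d)) <=
    expR (2 * b * d + d ^+ 2) * (expR b + expR (- b)).
Proof.
move=> d0 d8 db; have b0 : 0 <= b by lra.
have p1 := expR_gt0 b; have p2 := expR_gt0 (- b).
have p3 := expR_gt0 d; have p4 := expR_gt0 (- d).
have u1 : expR d <= (1 - d)^-1 by apply: expR_le_inv; lra.
have u2 : expR (- d) <= (1 + d)^-1 by apply: expRN_le_inv.
have u3 : 1 - d <= expR (- d) by have := expR_ge1Dx (- d); lra.
have ch : expR d + expR (- d) <= 2 + 128 / 63 * d ^+ 2.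
  apply: (le_trans (lerD u1 u2)).
  have -> : (1 - d)^-1 + (1 + d)^-1 = 2 / (1 - d ^+ 2).
    have n1 : 1 - d != 0 by rewrite gt_eqF //; lra.
    have n2 : 1 + d != 0 by rewrite gt_eqF //; lra.
    have n3 : 1 - d ^+ 2 != 0 by rewrite gt_eqF //; nra.
    by field; rewrite ?n1 ?n2 ?n3.
  have d2 : d ^+ 2 <= 1 / 64 by nra.
  have d20 : 0 <= d ^+ 2 by exact: sqr_ge0.
  by rewrite ler_pdivrMr; nra.
have sh : expR d - expR (- d) <= 15 / 7 * d.
  have : expR d - expR (- d) <= (1 - d)^-1 - (1 - d) by lra.
  move/le_trans; apply; rewrite lerBlDr -[(1 - d)^-1]mul1r ler_pdivrMr; nra.
have s0 : 0 <= expR d - expR (- d) by rewrite subr_ge0 ler_expR; lra.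
have sb := expR_sub_le b0.
have -> : expR (b + d) + expR (- (b + d)) =
  2^-1 * ((expR d + expR (- d)) * (expR b + expR (- b)) +
   (expR d - expR (- d)) * (expR b - expR (- b))).
  by rewrite opprD !expRD; field.
have : (expR d - expR (- d)) * (expR b - expR (- b)) <=
   15 / 7 * d * (3 / 2 * b * (expR b + expR (- b))).
  apply: le_trans (ler_wpM2l s0 sb) _.
  by apply: ler_wpM2r => //; rewrite !mulr_ge0 //; lra.
have := ler_wpM2r (ltW (addr_gt0 p1 p2)) ch.
have := ler_wpM2r (ltW (addr_gt0 p1 p2)) (expR_ge1Dx (2 * b * d + d ^+ 2)).
set cb := expR b + expR (- b).
have cb0 : 0 < cb by exact: addr_gt0.
(* Here [11/28 = 2 - 15/14 * 3/2] and [1/63 = 64/63 - 1]; [d <= 2 * b] lets the first term absorb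
   the second. *)
have : 0 <= (b * d * (11/28) - d ^+ 2 / 63) * cb by rewrite mulr_ge0 //; nra.
nra.
Qed.

End ExponentialBounds.

(** * Decay of the sum over one sliding window *)

Section Window.
Variables (R : realType) (M z : nat) (kappa : R) (g : nat -> R).
Hypotheses (M_gt0 : (0 < M)%N) (kappa_ge0 : 0 <= kappa).
Local Notation K := (2 * M%:R + 1).
Local Notation lam := (kappa / K ^+ 2).
Hypothesis g_ge0 : forall i, 0 <= g i.
Hypothesis g_decay : forall i,
  g i.+1 <= expR (- (lam * (z + i - M)%N%:R)) * g i.

Let K_gt0 : 0 < K :> R.
Proof. by have := ler0n R M; lra. Qed.

Let lam_ge0 : 0 <= lam.
Proof. by rewrite divr_ge0 // exprn_ge0 // ltW. Qed.

Let kappaE : kappa = lam * K ^+ 2.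
Proof. by rewrite divfK // expf_neq0 // gt_eqF. Qed.

Let rate_le : kappa / (1 + kappa) * z%:R / K ^+ 2 = lam * z%:R / (1 + kappa).
Proof. by rewrite -!mulrA; congr (_ * _); rewrite mulrC -mulrA mulrCA. Qed.

Let natB_ge (m n : nat) : (m%:R - n%:R : R) <= (m - n)%N%:R.
Proof.
have [mn|/ltnW mn] := leqP n m; first by rewrite natrB.
by rewrite (eqP (mn : (m - n == 0)%N)) subr_le0 ler_nat.
Qed.

(** With [g i] standing for [f (z + i)], the exponents [z + j - M] for [j < i] add up to this one.
    Replacing truncated subtraction by the true one only lowers the sum, hence weakens the bound. *)
Lemma window_gaussian_bound i :
  g i <= expR (- (lam * (i%:R * (z%:R - M%:R) + i%:R * (i%:R - 1) / 2))) * g 0%N.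
Proof.
elim: i => [|i IH]; first by rewrite !mul0r addr0 mulr0 oppr0 expR0 mul1r.
apply: le_trans (g_decay i) _.
apply: le_trans (ler_wpM2l (expR_ge0 _) IH) _.
rewrite mulrA -expRD ler_wpM2r // ler_expR -opprD lerN2 -mulrDr ler_wpM2l //.
have := natB_ge (z + i) M; rewrite natrD -natr1; lra.
Qed.

(** Sliding trades [g 0] for [g K]. Since [(K - 1) / 2 = M], the Gaussian bound at [K] has exponent
    exactly [u = lam K z], while [g 0] is at least the mean of the window. The condition [z <= K] is
    used as [u <= kappa]. *)
Lemma window_head : (z <= 2 * M + 1)%N ->
  \sum_(i < 2 * M + 1) g i.+1 <=
  expR (- (kappa / (1 + kappa) * z%:R / K ^+ 2)) * \sum_(i < 2 * M + 1) g i.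
Proof.
move=> zK; rewrite rate_le.
have KE : (2 * M + 1)%:R = K :> R by rewrite natrD natrM.
have zK' : z%:R <= K :> R by rewrite -KE ler_nat.
have gK := window_gaussian_bound (2 * M + 1).
have z0 : 0 <= z%:R :> R by [].
have g_mono i : g i.+1 <= g i.
  apply: le_trans (g_decay i) _; rewrite ler_piMl ?g_ge0 // expR_le1 oppr_le0.
  by rewrite mulr_ge0.
have gle i : g i <= g 0%N by elim: i => // i; apply: le_trans.
set S := \sum_(i < _) g i.
have Sle : S <= K * g 0%N.
  rewrite -KE mulr_natl -[X in _ *+ X]card_ord -sumr_const.
  by rewrite ler_sum // => i _; exact: gle.
have S0 : 0 <= S by apply: sumr_ge0 => i _; exact: g_ge0.
have -> : \sum_(i < 2 * M + 1) g i.+1 = S - g 0%N + g (2 * M + 1)%N.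
  rewrite /S addn1 big_ord_recr [X in _ = X - _ + _]big_ord_recl /=.
  by rewrite [g 0%N + _]addrC addrK.
have uE : (2 * M + 1)%:R * (z%:R - M%:R) + (2 * M + 1)%:R * ((2 * M + 1)%:R - 1) / 2
   = K * z%:R :> R by rewrite KE; field.
rewrite uE in gK.
set u := lam * (K * z%:R) in gK.
have u0 : 0 <= u by rewrite /u !mulr_ge0 // ltW.
have gK' : g (2 * M + 1)%N <= (1 + u)^-1 * g 0%N.
  by apply: le_trans gK _; rewrite ler_wpM2r // expRN_le_inv.
have p1u : 0 < 1 + u by rewrite ltr_pwDl.
have p1k : 0 < 1 + kappa by rewrite ltr_pwDl.
(* [1 - (1 - 1/(1+u))/K = 1 - lam z/(1+u)] and [u = lam K z <= kappa] *)
have uk : u <= kappa.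
  rewrite [leRHS]kappaE /u expr2 ler_wpM2l // ler_wpM2l //; exact: ltW.
apply: (@le_trans _ _ (S * (1 - lam * z%:R / (1 + u)))).
  have -> : lam * z%:R = u / K by rewrite /u -[RHS]mulrA [K * _ / K]mulrC mulKf // gt_eqF.
  have -> : S * (1 - u / K / (1 + u)) = S - S / K * (u / (1 + u)) by ring.
  have hS : S / K <= g 0%N by rewrite ler_pdivrMr // mulrC.
  have q0 : 0 <= u / (1 + u) by rewrite divr_ge0 // ltW.
  have Eu : (1 + u)^-1 = 1 - u / (1 + u).
    by rewrite -[X in X - _](divff (lt0r_neq0 p1u)) -mulrBl addrK mul1r.
  rewrite Eu in gK'; have := ler_wpM2r q0 hS; move: gK'.
  move: (u / (1 + u)) (S / K) => w v; lra.
rewrite mulrC ler_wpM2r //; apply: le_trans (expR_ge1Dx _).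
rewrite lerD2l lerN2 ler_wpM2l ?mulr_ge0 // lef_pV2 ?posrE //; lra.
Qed.

(** The comparison is termwise: [z > 2 M] gives [z - M >= z / 2], and [1 / (1 + kappa) <= 1 / 2]. *)
Lemma window_tail_large : (2 * M + 1 < z)%N -> 1 <= kappa ->
  \sum_(i < 2 * M + 1) g i.+1 <=
  expR (- (kappa / (1 + kappa) * z%:R / K ^+ 2)) * \sum_(i < 2 * M + 1) g i.
Proof.
move=> zK k1; rewrite rate_le mulr_sumr; apply: ler_sum => i _.
apply: le_trans (g_decay i) _; rewrite ler_wpM2r // ler_expR lerN2.
rewrite -mulrA ler_wpM2l // ler_pdivrMr; last lra.
have h1 := natB_ge (z + i) M; rewrite natrD in h1.
have h2 : 2 * M%:R + 1 <= z%:R :> R by rewrite -natrM natr1 ler_nat; lia.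
have h3 : 0 <= i%:R :> R by [].
have h4 : 0 <= M%:R :> R by [].
apply: (@le_trans _ _ ((z%:R - M%:R) * (1 + kappa))); first by nra.
by rewrite ler_wpM2r; lra.
Qed.

(** The extremal [g] is the Gaussian profile of [window_gaussian_bound]; for it the loss from the
    spread of the window is a ratio of hyperbolic cosines, which [cosh_shift_le] bounds. *)
Lemma window_tail_small : (2 * M + 1 < z)%N -> kappa <= 1 ->
  \sum_(i < 2 * M + 1) g i.+1 <=
  expR (- (kappa / (1 + kappa) * z%:R / K ^+ 2)) * \sum_(i < 2 * M + 1) g i.
Proof.
move=> zK k1; rewrite rate_le.
set rho := expR _.
pose F (i : nat) : R := expR (- (lam * (i%:R * (z%:R - M%:R) + i%:R * (i%:R - 1) / 2))).
have p1k : 0 < 1 + kappa by rewrite ltr_pwDl.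
have rho1 : rho <= 1.
  by rewrite /rho expR_le1 oppr_le0 divr_ge0 ?mulr_ge0 // ltW.
have F0 : F 0%N = 1 by rewrite /F !mul0r addr0 mulr0 oppr0 expR0.
suff HF : \sum_(i < 2 * M + 1) (F i.+1 - rho * F i) <= 0.
  (* Regrouping by index leaves [G 0] as the only value with a negative coefficient, so each other
     value of [g] may be replaced by its upper bound [F i * g 0]. *)
  have split_sum (G : nat -> R) : \sum_(i < 2 * M + 1) (G i.+1 - rho * G i) =
      G (2 * M + 1)%N + (1 - rho) * \sum_(i < 2 * M) G i.+1 - rho * G 0%N.
    rewrite sumrB -mulr_sumr addn1 big_ord_recr /=.
    by rewrite [X in _ - _ * X]big_ord_recl /=; lra.
  rewrite -subr_le0 mulr_sumr -sumrB split_sum.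
  rewrite split_sum F0 in HF.
  apply: le_trans (_ : (F (2 * M + 1)%N + (1 - rho) * \sum_(i < 2 * M) F i.+1
     - rho * 1) * g 0%N <= 0).
    rewrite [leRHS]mulrBl mulr1 lerD2r [leRHS]mulrDl lerD //; first exact: window_gaussian_bound.
    rewrite -mulrA mulr_suml ler_wpM2l ?subr_ge0 // ler_sum // => i _.
    exact: window_gaussian_bound.
  exact: mulr_le0_ge0.
(* the terms i and 2M - i of the window are paired *)
suff Hpair (i : 'I_(2 * M + 1)) :
    F i.+1 - rho * F i + (F (rev_ord i).+1 - rho * F (rev_ord i)) <= 0.
  have Erev : \sum_(i < 2 * M + 1) (F i.+1 - rho * F i) =
      \sum_(i < 2 * M + 1) (F (rev_ord i).+1 - rho * F (rev_ord i)).
    exact: (reindex_inj rev_ord_inj).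
  rewrite -(@pmulrn_lle0 _ _ 2) // mulr2n [X in _ + X]Erev -big_split /=.
  by apply: sumr_le0 => i _; exact: Hpair.
pose s : R := i%:R - M%:R.
have Ei : i%:R = M%:R + s by rewrite /s; ring.
have Er : (rev_ord i)%:R = M%:R - s :> R.
  rewrite /s /= natrB ?ltn_ord // natrD natrM -[i.+1%:R]natr1; lra.
(* Expansion about the centre [M] of the window: [C] depends on the offset [s] only through
   [s ^+ 2], so paired terms share it. *)
pose C : R := lam * (M%:R * (z%:R - M%:R) + M%:R * (M%:R - 1) / 2 + s ^+ 2 / 2).
have FE (j : nat) (t : R) : j%:R = M%:R + t -> t ^+ 2 = s ^+ 2 ->
    F j = expR (- C) * expR (- (lam * (t * (z%:R - 1 / 2)))).
  move=> Ej Et; rewrite /F -expRD; congr expR; rewrite /C -Et Ej; field.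
  by rewrite gt_eqF.
have FE1 (j : nat) (t : R) : j%:R = M%:R + t -> t ^+ 2 = s ^+ 2 ->
    F j.+1 = expR (- C) * expR (- (lam * z%:R)) * expR (- (lam * (t * (z%:R + 1 / 2)))).
  move=> Ej Et; rewrite /F -!expRD; congr expR; rewrite /C -Et -[j.+1%:R]natr1 Ej; field.
  by rewrite gt_eqF.
rewrite (FE _ _ Ei erefl) (FE1 _ _ Ei erefl) (FE _ _ Er (sqrrN s)) (FE1 _ _ Er (sqrrN s)).
have sM : `|s| <= M%:R.
  have := ltn_ord i; rewrite -(ler_nat R) -[i.+1%:R]natr1 natrD natrM Ei => h.
  by have := ler0n R i; rewrite Ei ler_norml; lra.
have hM : 1 <= M%:R :> R by rewrite ler1n.
pose dl := lam * `|s|.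
have dl0 : 0 <= dl by rewrite mulr_ge0.
have lamK : lam * K ^+ 2 <= 1 by rewrite -kappaE.
have hz : 4 <= z%:R :> R by rewrite ler_nat; lia.
have dl8 : dl <= 1 / 8.
  (* Uses [|s| <= M] and [8 M <= (2 M + 1) ^ 2], that is [(2 M - 1) ^ 2 >= 0]. *)
  have h : dl * 8 <= lam * K ^+ 2.
    rewrite /dl -mulrA ler_wpM2l //; nra.
  lra.
pose b := dl * (z%:R - 1 / 2).
have db : dl <= 2 * b by rewrite /b; nra.
have := cosh_shift_le dl0 dl8 db.
have -> : b + dl = dl * (z%:R + 1 / 2) by rewrite /b; field.
have symE (c : R) : expR (dl * c) + expR (- (dl * c)) =
    expR (- (lam * (s * c))) + expR (- (lam * (- s * c))).
  rewrite /dl !mulNr mulrN opprK; have [s0|s0] := leP 0 s.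
    by rewrite ger0_norm // -!mulrA addrC.
  by rewrite ltr0_norm // mulrN !mulNr opprK -!mulrA.
rewrite /b !symE => hc.
(* The exponent is [2 z dl ^ 2], and [lam * 2 s ^ 2 * (1 + kappa) <= 4 lam M ^ 2 <= lam K ^ 2 =
   kappa]. *)
have hexp : expR (2 * (dl * (z%:R - 1 / 2)) * dl + dl ^+ 2) <= rho * expR (lam * z%:R).
  rewrite /rho -expRD ler_expR.
  have -> : - (lam * z%:R / (1 + kappa)) + lam * z%:R = lam * z%:R * (kappa / (1 + kappa)).
    by field; rewrite !gt_eqF.
  have -> : 2 * (dl * (z%:R - 1 / 2)) * dl + dl ^+ 2 = lam * z%:R * (lam * (2 * s ^+ 2)).
    by rewrite -[s ^+ 2]real_normK ?num_real // /dl; field; rewrite gt_eqF.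
  apply: ler_wpM2l; first by rewrite mulr_ge0.
  rewrite ler_pdivlMr // [leRHS]kappaE -[leLHS]mulrA; apply: ler_wpM2l => //.
  have s2 : s ^+ 2 <= M%:R ^+ 2.
    by rewrite -[s ^+ 2]real_normK ?num_real // lerXn2r ?nnegrE.
  nra.
set c1 := expR (- (lam * (s * (z%:R + _)))) in hc *.
set c2 := expR (- (lam * (- s * (z%:R + _)))) in hc *.
set d1 := expR (- (lam * (s * (z%:R - _)))) in hc *.
set d2 := expR (- (lam * (- s * (z%:R - _)))) in hc *.
have d0 : 0 <= d1 + d2 by rewrite addr_ge0 // expR_ge0.
have hc' : c1 + c2 <= rho * expR (lam * z%:R) * (d1 + d2).
  exact: le_trans hc (ler_wpM2r d0 hexp).
have := ler_wpM2l (expR_ge0 (- (lam * z%:R))) hc'.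
rewrite [leRHS](_ : _ = rho * (d1 + d2) * (expR (- (lam * z%:R)) * expR (lam * z%:R)));
  last by ring.
rewrite -expRD addNr expR0 mulr1 => hc2.
have := ler_wpM2l (expR_ge0 (- C)) hc2.
lra.
Qed.

Lemma window_contraction :
  \sum_(i < 2 * M + 1) g i.+1 <=
  expR (- (kappa / (1 + kappa) * z%:R / K ^+ 2)) * \sum_(i < 2 * M + 1) g i.
Proof.
have [zK|zK] := leqP z (2 * M + 1); first exact: window_head.
have [k1|/ltW k1] := leP 1 kappa; first exact: window_tail_large.
exact: window_tail_small.
Qed.

End Window.

(** * Decay of even functions on the integers *)

Section Decay.
Variables (R : realType) (M : nat).
Implicit Types (kappa : R) (f g : int -> R) (x y : int).
Local Notation K := (2 * M%:R + 1).

(* The step from [j] to [j + 1] decays at least as fast as for a Gaussian of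
   variance [K ^+ 2 / kappa] centred at [M + 1 / 2]. *)
Definition decay kappa f : Prop :=
  [/\ forall x, 0 <= f x, forall x, f (- x) = f x
    & forall j : nat,
        f j.+1 <= expR (- (kappa / K ^+ 2 * (j - M)%N%:R)) * f j].

Definition box f x : R := \sum_(i < 2 * M + 1) f (x - M%:Z + i%:Z).

Lemma eq_decay kappa f g : f =1 g -> decay kappa f -> decay kappa g.
Proof.
move=> fg [f0 fN fd]; split => [x|x|j]; rewrite -!fg //; exact: fd.
Qed.

Lemma decay_rate_ge0 kappa (n : nat) : 0 <= kappa -> 0 <= kappa / K ^+ 2 * n%:R :> R.
Proof. by move=> k0; rewrite mulr_ge0 // divr_ge0 // exprn_ge0 // addr_ge0 // mulr_ge0. Qed.

Lemma decay_absz kappa f x : decay kappa f -> f `|x|%N = f x.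
Proof.
case=> _ fN _; have [x0|x0] := leP 0 x; first by rewrite gez0_abs.
by rewrite ltz0_abs.
Qed.

Lemma decay_le kappa f x y : 0 <= kappa -> decay kappa f ->
  (`|x| <= `|y|)%N -> f y <= f x.
Proof.
move=> k0 fd; rewrite -(decay_absz x fd) -(decay_absz y fd).
move: `|x|%N `|y|%N => i j; case: fd => f0 fN fd /subnKC <-.
elim: (j - i)%N => [|n IH]; first by rewrite addn0.
rewrite addnS; apply: le_trans (fd _) _; apply: le_trans IH.
by rewrite ler_piMl // expR_le1 oppr_le0 decay_rate_ge0.
Qed.

Lemma decayM kappa1 kappa2 f g : decay kappa1 f -> decay kappa2 g ->
  decay (kappa1 + kappa2) (fun x => f x * g x).
Proof.
move=> [f0 fN fd] [g0 gN gd]; split => [x|x|j]; rewrite ?mulr_ge0 ?fN ?gN //.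
rewrite [(kappa1 + _) / _]mulrDl [(_ / _ + _) * _]mulrDl opprD expRD mulrACA.
by rewrite ler_pM ?f0 ?g0 ?fd ?gd.
Qed.

Lemma decay_indicator (B : nat) : decay 0 (fun x => (`|x| <= B)%N%:R).
Proof.
split => [x|x|j]; rewrite ?ler0n ?abszN //.
rewrite !mul0r oppr0 expR0 mul1r ler_nat !absz_nat.
by case: leqP => // /ltnW ->.
Qed.

Lemma box_step f x : box f (x + 1) + f (x - M%:Z) = box f x + f (x + M.+1%:Z).
Proof.
pose h (i : nat) := f (x - M%:Z + i%:Z).
have -> : box f (x + 1) = \sum_(i < 2 * M + 1) h i.+1.
  by apply: eq_bigr => i _; rewrite /h; congr f; lia.
have -> : f (x - M%:Z) = h 0%N by rewrite /h addr0.
have -> : f (x + M.+1%:Z) = h (2 * M + 1)%N by rewrite /h; congr f; lia.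
transitivity (\sum_(i < (2 * M + 1).+1) h i); last by rewrite big_ord_recr.
by rewrite big_ord_recl addrC.
Qed.

Lemma boxN f x : (forall x, f (- x) = f x) -> box f (- x) = box f x.
Proof.
move=> fN; rewrite /box (reindex_inj rev_ord_inj) /=.
by apply: eq_bigr => i _; rewrite -fN; congr f; have := ltn_ord i; lia.
Qed.

(** For [j <= M] the required rate is 0, and the step trades [f (j - M)] for [f (j + M + 1)], which
    is farther from 0. For [j > M] the window stays on the positive integers and
    [window_contraction] applies with [z = j - M]. *)
Lemma decay_box kappa f : (0 < M)%N -> 0 <= kappa -> decay kappa f ->
  decay (kappa / (1 + kappa)) (box f).
Proof.
move=> M0 k0 fD; have [f0 fN fd] := fD; split => [x|x|j].
- by apply: sumr_ge0 => i _.
- exact: boxN.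
have [jM|Mj] := leqP j M.
  rewrite (eqP (jM : (j - M == 0)%N)) mulr0 oppr0 expR0 mul1r.
  have := box_step f j%:Z; rewrite (_ : j%:Z + 1 = j.+1); last by lia.
  move=> E; suff : f (j%:Z + M.+1%:Z) <= f (j%:Z - M%:Z) by lra.
  by apply: (decay_le k0 fD); lia.
pose z := (j - M)%N.
have Ej i : j%:Z - M%:Z + i%:Z = (z + i)%N by rewrite /z; lia.
have Ej1 i : j.+1%:Z - M%:Z + i%:Z = (z + i).+1%N by rewrite /z; lia.
have := @window_contraction R M z kappa (fun i => f (z + i)%N) M0 k0 _ _.
have -> : box f j = \sum_(i < 2 * M + 1) f (z + i)%N.
  by apply: eq_bigr => i _; rewrite Ej.
have -> : box f j.+1 = \sum_(i < 2 * M + 1) f (z + i.+1)%N.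
  by apply: eq_bigr => i _; rewrite Ej1; congr f; lia.
rewrite [_ / _ * _ / _]mulrAC; apply => // i.
by rewrite addnS.
Qed.

(** The box of a point mass is the indicator of [[-M, M]], where the truncated exponent vanishes, so
    every rate would do; 1 is the conductance of the edge above a leaf. *)
Lemma decay_box_delta f : (forall x, f x = (x == 0)%:R) -> decay 1 (box f).
Proof.
move=> fE.
have bE x : box f x = (`|x| <= M)%N%:R.
  rewrite /box; under eq_bigr do rewrite fE.
  case: leqP => xM.
    have xl : (`|M%:Z - x|%N < 2 * M + 1)%N by lia.
    rewrite (bigD1 (Ordinal xl)) //= big1 ?addr0; first by case: eqP => //; lia.
    move=> i /eqP/eqP; rewrite -val_eqE /= => ni.
    by case: eqP => // ?; lia.
  rewrite big1 // => i _; case: eqP => //; have := ltn_ord i; lia.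
split => [x|x|j]; rewrite !bE ?ler0n ?abszN //.
case: (leqP _ M) => [|_]; last by rewrite mulr_ge0 ?expR_ge0.
rewrite !absz_nat => jM; rewrite (eqP (ltnW jM : (j - M == 0)%N)).
by rewrite mulr0 oppr0 expR0 mul1r (ltnW jM).
Qed.

Lemma sum_ord_shift (B : nat) (F : int -> R) :
  \sum_(i < 2 * B + 1) F (i%:Z - B%:Z) =
  F 0 + \sum_(j < B) (F j.+1%:Z + F (- j.+1%:Z)).
Proof.
elim: B => [|B IH]; first by rewrite muln0 add0n big_ord1 big_ord0 !addr0.
rewrite (_ : (2 * B.+1 + 1 = (2 * B + 1).+2)%N); last by lia.
rewrite big_ord_recl big_ord_recr /= [in RHS]big_ord_recr /=.
have -> : \sum_(i < 2 * B + 1) F ((bump 0 i)%:Z - B.+1%:Z) =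
   \sum_(i < 2 * B + 1) F (i%:Z - B%:Z).
  by apply: eq_bigr => i _; congr F; rewrite /bump /=; lia.
have -> : F ((bump 0 (2 * B + 1))%:Z - B.+1%:Z) = F B.+1.
  by congr F; rewrite /bump /=; lia.
by rewrite IH sub0r; ring.
Qed.

Lemma sum_nat_shift (f : nat -> R) (B : nat) :
  \sum_(j < B) j.+1%:R * (f j - f j.+1) + B%:R * f B = \sum_(j < B) f j.
Proof.
elim: B => [|B IH]; first by rewrite !big_ord0 mul0r addr0.
by rewrite !big_ord_recr /= -IH -[B.+1%:R]natr1; ring.
Qed.

(* The decay of [f] gives [(j - M) f (j + 1) <= (K ^+ 2 / kappa) (f j - f (j + 1))];
   multiply by [j + 1] and sum by parts. *)
Lemma decay_second_moment kappa f (B : nat) : 0 < kappa -> decay kappa f ->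
  \sum_(i < 2 * B + 1) (i%:Z - B%:Z)%:~R ^+ 2 * f (i%:Z - B%:Z) <=
  (4 * K ^+ 2 / kappa + (M%:R + 1) ^+ 2) * \sum_(i < 2 * B + 1) f (i%:Z - B%:Z).
Proof.
move=> k0 [f0 fN fd].
rewrite (sum_ord_shift B (fun x => x%:~R ^+ 2 * f x)) (sum_ord_shift B f).
rewrite expr0n mul0r add0r.
have K0 : 0 < K ^+ 2 :> R by rewrite exprn_gt0 // ltr_wpDl // mulr_ge0.
pose t := K ^+ 2 / kappa; have t0 : 0 < t by rewrite divr_gt0.
have step (j : nat) : (j%:R - M%:R) * f j.+1 <= t * (f j - f j.+1).
  have := fd j; set a := _ * (j - M)%N%:R => fa.
  have a0 : 0 <= a by apply: decay_rate_ge0; exact: ltW.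
  have : f j.+1 * (1 + a) <= f j.
    rewrite -ler_pdivlMr ?ltr_pwDl // mulrC; apply: le_trans fa _.
    by rewrite ler_wpM2r // expRN_le_inv.
  have at_ : t * a = (j - M)%N%:R.
    by rewrite /t /a mulrA mulf_div [kappa * _]mulrC divff ?mul1r // gt_eqF // mulr_gt0.
  have : (j%:R - M%:R) * f j.+1 <= (j - M)%N%:R * f j.+1.
    rewrite ler_wpM2r //; have [mn|/ltnW mn] := leqP M j; first by rewrite natrB.
    by rewrite (eqP (mn : (j - M == 0)%N)) subr_le0 ler_nat.
  rewrite -at_; nra.
have F1 (j : nat) : j.+1%:R ^+ 2 * f j.+1 <=
    2 * t * (j.+1%:R * (f j - f j.+1)) + (M%:R + 1) ^+ 2 * f j.+1.
  have := step j; have j1 : (0 : R) <= j.+1%:R by [].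
  have Ej : j%:R = j.+1%:R - 1 :> R by rewrite -[j.+1%:R]natr1 addrK.
  rewrite Ej => h.
  have h1 := ler_wpM2l j1 h.
  (* With [n = j + 1], this square gives [n ^ 2 <= 2 n (n - (M + 1)) + (M + 1) ^ 2], whose first
     term [step] controls. *)
  have h2 : 0 <= (j.+1%:R - (M%:R + 1)) ^+ 2 * f j.+1.
    by rewrite mulr_ge0 // sqr_ge0.
  move: h1 h2; move: (j.+1%:R) (f j.+1) (f j) (M%:R : R) => *; nra.
have -> : \sum_(j < B) ((j.+1%:Z%:~R : R) ^+ 2 * f j.+1 + (- j.+1%:Z)%:~R ^+ 2 * f (- j.+1%:Z))
    = 2 * \sum_(j < B) j.+1%:R ^+ 2 * f j.+1.
  by rewrite mulr_sumr; apply: eq_bigr => j _; rewrite fN mulrNz sqrrN -pmulrn; ring.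
have -> : \sum_(j < B) (f j.+1 + f (- j.+1%:Z)) = 2 * \sum_(j < B) f j.+1.
  by rewrite mulr_sumr; apply: eq_bigr => j _; rewrite fN; ring.
have H : \sum_(j < B) j.+1%:R ^+ 2 * f j.+1 <=
   2 * t * \sum_(j < B) f j + (M%:R + 1) ^+ 2 * \sum_(j < B) f j.+1.
  apply: (@le_trans _ _ (2 * t * \sum_(j < B) (j.+1%:R * (f j - f j.+1))
     + (M%:R + 1) ^+ 2 * \sum_(j < B) f j.+1)).
    by rewrite !mulr_sumr -big_split /=; apply: ler_sum => j _; exact: F1.
  rewrite lerD2r; apply: ler_wpM2l; first by rewrite mulr_ge0 // ltW.
  rewrite -[leRHS](sum_nat_shift (fun j : nat => f j) B).
  by rewrite lerDl mulr_ge0.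
have H2 : \sum_(j < B) f j <= f 0 + \sum_(j < B) f j.+1.
  case: (B) => [|B']; first by rewrite !big_ord0 addr0.
  by rewrite big_ord_recl lerD2l big_ord_recr /= lerDl.
have S0 : 0 <= \sum_(j < B) f j.+1 by apply: sumr_ge0 => j _; exact: f0.
have -> : 4 * K ^+ 2 / kappa = 4 * t by rewrite /t mulrA.
have H3 := ler_wpM2l (ltW t0) H2.
have h0 := f0 0; have M0 : (0 : R) <= (M%:R + 1) ^+ 2 by rewrite sqr_ge0.
have := mulr_ge0 M0 h0; have := mulr_ge0 (ltW t0) S0.
move: H H3; set S2 := \sum_(j < B) _ * _; move: (\sum_(j < B) f j.+1) (\sum_(j < B) f j) => *.
nra.
Qed.

End Decay.

(** * Rooted trees *)

Section RootedTree.
Variables (V : finType) (e : rel V) (root : V).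
Hypothesis T_tree : is_tree e.
Local Notation dist := (distance e root).
Local Notation child := (child e root).
Local Notation leaf := (leaf e root).
Implicit Types u v w : V.

Lemma distance_le p v : path e root p -> last root p = v -> (dist v <= size p)%N.
Proof.
move=> ep lp; rewrite leqNgt; apply/negP => lt.
have := before_find 0%N lt; rewrite nth_iota; last first.
  by apply: leq_trans lt _; rewrite -[leqRHS](size_iota 0) find_size.
move/existsP; apply; exists (in_tuple p) => /=.
by rewrite ep lp /=.
Qed.

Lemma distance_path v :
  exists p, [/\ path e root p, last root p = v & size p = dist v].
Proof.
have [_ _ conn _] := T_tree.
have hs : has (fun n => [exists p : n.-tuple V, path e root p && (last root p == v)])
   (iota 0 #|V|).
  have /connectP[p ep ->] := conn root v.
  case: (shortenP ep) => p' ep' up' _; apply/hasP; exists (size p').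
    rewrite mem_iota /= add0n; have := max_card (mem (root :: p')).
    by rewrite (card_uniqP up').
  by apply/existsP; exists (in_tuple p'); rewrite ep' /=.
have := nth_find 0%N hs; rewrite nth_iota; last by rewrite -[ltnRHS](size_iota 0) -has_find.
rewrite add0n => /existsP[p /andP[ep /eqP lp]]; exists p; split => //.
exact: size_tuple.
Qed.

Lemma distance_lt v : (dist v < #|V|)%N.
Proof.
have [p [ep lp _]] := distance_path v.
rewrite -lp; case: (shortenP ep) => p' ep' up' _.
apply: leq_ltn_trans (distance_le ep' erefl) _.
by have := max_card (mem (root :: p')); rewrite (card_uniqP up').
Qed.

Lemma distance_root : dist root = 0%N.
Proof. by apply/eqP; rewrite -leqn0; exact: (@distance_le [::]). Qed.

Lemma distance_eq0 v : dist v = 0%N -> v = root.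
Proof. by have [p [_ <- <-]] := distance_path v => /size0nil ->. Qed.

Lemma distance_edge u v : e u v -> (dist v <= (dist u).+1)%N.
Proof.
move=> uv; have [p [ep lp <-]] := distance_path u.
rewrite -(size_rcons p v); apply: distance_le; last exact: last_rcons.
by rewrite rcons_path ep lp.
Qed.

Lemma distance_pred v : v != root -> exists u, child u v.
Proof.
move=> vr; have [p [ep lp sp]] := distance_path v.
case: (lastP p) ep lp sp => [_ /= rv|p' w]; first by rewrite rv eqxx in vr.
rewrite rcons_path last_rcons size_rcons => /andP[ep' ew] <- sp.
exists (last root p'); rewrite /Defs.child ew -sp eqSS.
by rewrite eqn_leq -ltnS sp distance_edge //= distance_le.
Qed.

Lemma child_neq_root u v : child u v -> v != root.
Proof. by case/andP => _ /eqP dv; apply/eqP => E; rewrite E distance_root in dv. Qed.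

(** Follow predecessors back to the root. The strict bound keeps such a walk off any other vertex at
    least as far away as [u]. *)
Lemma distance_geodesic u :
  exists p, [/\ path e root p, last root p = u
    & forall x, x \in root :: p -> x = u \/ (dist x < dist u)%N].
Proof.
have [n] := ubnP (dist u); elim: n u => // n IH u; rewrite ltnS => du.
have [->|ur] := eqVneq u root.
  by exists [::]; split => // x; rewrite inE => /eqP; left.
have [w /andP[ew /eqP dw]] := distance_pred ur.
have [|p [ep lp Hp]] := IH w; first by rewrite -dw.
exists (rcons p u); split; first by rewrite rcons_path ep lp.
  by rewrite last_rcons.
move=> x; rewrite -rcons_cons mem_rcons inE => /orP[/eqP|/Hp]; first by left.
by rewrite dw; case=> [->|xw]; right; rewrite // ltnW.
Qed.

(* Two distinct such neighbours would be joined by a walk through the root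
   avoiding [v], hence would close a cycle through [v]. *)
Lemma lower_neighbour_unique u v w : e v u -> e v w ->
  (dist u <= dist v)%N -> (dist w <= dist v)%N -> u = w.
Proof.
have [esym eirr _ acyc] := T_tree.
move=> vu vw du dw; apply/eqP; apply: contraT => uw.
pose e' := [rel x y | [&& e x y, x != v & y != v]].
have e'C : connect_sym e'.
  by apply: sym_connect_sym => x y /=; rewrite esym [(x != v) && _]andbC.
have root_conn x : e v x -> (dist x <= dist v)%N -> connect e' root x.
  move=> vx dx; have [p [ep lp Hp]] := distance_geodesic x.
  have nv y : y \in root :: p -> y != v.
    move=> /Hp[->|yx]; apply/eqP => E; first by rewrite E eirr in vx.
    by move: (leq_trans yx dx); rewrite E ltnn.
  apply/connectP; exists p => //.
  elim: (p) (root) ep nv => //= y q IH z /andP[zy eq] nv.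
  by rewrite zy !nv ?inE ?eqxx ?orbT //= IH // => t tq; rewrite nv // inE tq orbT.
have : connect e' u w.
  by apply: (connect_trans (y := root)); first rewrite e'C; exact: root_conn.
case/connectP => p ep lp; move: uw; rewrite lp.
case: (shortenP ep) lp => q eq uq _ lp uw.
have nvq : v \notin u :: q.
  rewrite inE negb_or; apply/andP; split.
    by apply/eqP => E; rewrite -E eirr in vu.
  elim: (q) (u) eq => //= y r IH z /andP[/and3P[_ _ yv] yr].
  by rewrite inE negb_or eq_sym yv (IH y yr).
have : (size [:: v, u & q] <= 2)%N.
  apply: acyc; rewrite /ucycle /= vu nvq rcons_path -lp esym vw andbT.
  by move: uq => /= ->; rewrite andbT; apply: sub_path eq => x y /= /andP[].
by rewrite /= !ltnS leqn0 => /nilP q0; rewrite q0 eqxx in uw.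
Qed.

Lemma edge_child u v : e u v -> child u v || child v u.
Proof.
have [esym eirr _ _] := T_tree.
wlog du : u v / (dist u <= dist v)%N.
  move=> H uv; have [|/ltnW] := leqP (dist u) (dist v); first by move/H; apply.
  by move/H; rewrite orbC; apply; rewrite esym.
move=> uv; have vr : v != root.
  apply/eqP => E; rewrite E distance_root leqn0 in du.
  by move: uv; rewrite E (distance_eq0 (eqP du)) eirr.
have [w /andP[wv /eqP dw]] := distance_pred vr.
have -> : u = w.
  by apply: (@lower_neighbour_unique _ v) => //; rewrite 1?esym // dw.
by rewrite {1}/Defs.child wv dw eqxx.
Qed.

Definition parent v : V := odflt v [pick u | child u v].

Lemma child_parent v : v != root -> child (parent v) v.
Proof.
move=> /distance_pred[u uv]; rewrite /parent; case: pickP => [//|/(_ u)].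
by rewrite uv.
Qed.

Lemma parentE u v : child u v -> parent v = u.
Proof.
have [esym _ _ _] := T_tree.
move=> uv; have /child_parent := child_neq_root uv.
case/andP: uv => uv /eqP du /andP[pv /eqP dp].
apply: (@lower_neighbour_unique _ v); rewrite 1?esym //.
  by rewrite dp.
by rewrite du.
Qed.

Lemma childE u v : child u v = (v != root) && (u == parent v).
Proof.
apply/idP/andP => [uv|[vr /eqP ->]]; last exact: child_parent.
by rewrite (child_neq_root uv) (parentE uv).
Qed.

Lemma edgeE u v : e u v = child u v || child v u.
Proof.
have [esym _ _ _] := T_tree.
apply/idP/orP => [/edge_child/orP //|[/andP[]|/andP[]]//].
by rewrite esym.
Qed.

Lemma child_asym u v : child u v -> ~~ child v u.
Proof. by move=> /andP[_ /eqP d]; apply/negP => /andP[_]; rewrite d; lia. Qed.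

(** * Conductances of subtrees *)

Section Conductance.
Variable R : realType.

(** The recursion runs on fuel because the tree is given by its edge relation. A leaf is grounded,
    so only the unit edge above it counts; otherwise [C / (1 + C)] is the series law. The value at
    fuel 0 is a default. *)
Fixpoint conductance_fuel (n : nat) v : R :=
  if n isn't n'.+1 then 1 else
  if leaf v then 1 else
  (\sum_(c | child v c) conductance_fuel n' c)
    / (1 + \sum_(c | child v c) conductance_fuel n' c).

(* The effective conductance to the leaves of the subtree of [v] in series with
   the edge from [v] to its parent. *)
Definition branch_conductance v : R := conductance_fuel #|V| v.

Definition subtree_conductance v : R := \sum_(c | child v c) branch_conductance c.

Lemma conductance_fuel_gt0 n v : 0 < conductance_fuel n v.
Proof.
elim: n v => //= n IH v; case: ifPn => // /forallPn[u]; rewrite negbK => vu.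
have S0 : 0 < \sum_(c | child v c) conductance_fuel n c.
  rewrite (bigD1 u) //= ltr_pwDl // sumr_ge0 // => c _; exact: ltW.
by rewrite divr_gt0 // addr_gt0.
Qed.

(** Going down to a child raises the distance by one, and distances stay below [#|V|], so the leaves
    are reached before the fuel runs out. *)
Lemma conductance_fuelS n v : (#|V| <= dist v + n)%N ->
  conductance_fuel n.+1 v = conductance_fuel n v.
Proof.
elim: n v => [|n IH] v; first by rewrite addn0 leqNgt distance_lt.
move=> Vn; have E : \sum_(c | child v c) conductance_fuel n.+1 c =
    \sum_(c | child v c) conductance_fuel n c.
  apply: eq_bigr => c /andP[_ /eqP dc]; apply: IH.
  by rewrite dc addSnnS.
by rewrite -/(conductance_fuel n.+2 v) [LHS]/= -/(conductance_fuel n.+1) E.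
Qed.

Lemma branch_conductance_gt0 v : 0 < branch_conductance v.
Proof. exact: conductance_fuel_gt0. Qed.

Lemma subtree_conductance_ge0 v : 0 <= subtree_conductance v.
Proof. by apply: sumr_ge0 => c _; rewrite ltW // branch_conductance_gt0. Qed.

Lemma subtree_conductance_gt0 v : ~~ leaf v -> 0 < subtree_conductance v.
Proof.
move=> /forallPn[u]; rewrite negbK => vu; rewrite /subtree_conductance (bigD1 u) //=.
rewrite ltr_pwDl ?branch_conductance_gt0 // sumr_ge0 // => c _.
by rewrite ltW // branch_conductance_gt0.
Qed.

Lemma branch_conductanceE v : branch_conductance v =
  if leaf v then 1 else subtree_conductance v / (1 + subtree_conductance v).
Proof. by rewrite {1}/branch_conductance -conductance_fuelS // leq_addl. Qed.

End Conductance.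
End RootedTree.

(** * Effective resistance of a tree *)

Section Network.
Variable R : realType.

Lemma sum_indicator_mul (W : finType) (h : W -> R) (a : W) :
  \sum_x (x == a)%:R * h x = h a.
Proof.
rewrite (bigD1 a) //= eqxx mul1r big1 ?addr0 // => x /negPf ->.
by rewrite mul0r.
Qed.

(** The potential itself is not unique, since identified vertices leave isolated nodes behind, but
    all solutions have the same difference between [a] and [z], so [xget] can return only this
    value. *)
Lemma effective_resistance_eq (W : finType) (c : W -> W -> R) (a z : W) (h : W -> R) :
  (forall x y, c x y = c y x) ->
  (forall x, \sum_y c x y * (h x - h y) = (x == a)%:R - (x == z)%:R) ->
  effective_resistance c a z = h a - h z.
Proof.
move=> cC Lh; apply: xget_unique; first by exists h.
move=> _ [h' Lh' ->].
(* reciprocity: the network Laplacian is self-adjoint *)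
have pairing (k : W -> R) : \sum_x ((x == a)%:R - (x == z)%:R) * k x = k a - k z.
  by under eq_bigr do rewrite mulrBl; rewrite sumrB !sum_indicator_mul.
have adjoint (k l : W -> R) : \sum_x (\sum_y c x y * (k x - k y)) * l x =
    \sum_x \sum_y c x y * k x * l x - \sum_x \sum_y c x y * k y * l x.
  rewrite -sumrB; apply: eq_bigr => x _; rewrite mulr_suml -sumrB.
  by apply: eq_bigr => y _; ring.
rewrite -(pairing h) -(pairing h').
under eq_bigr do rewrite -Lh; under [RHS]eq_bigr do rewrite -Lh'.
rewrite !adjoint; congr (_ - _).
  by apply: eq_bigr => x _; apply: eq_bigr => y _; ring.
rewrite exchange_big; apply: eq_bigr => x _; apply: eq_bigr => y _.
by rewrite cC; ring.
Qed.

Lemma identify_sym (V : finType) (A : pred V) (c : V -> V -> R) :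
  (forall x y, c x y = c y x) ->
  forall i j, identify A c i j = identify A c j i.
Proof.
move=> cC i j; rewrite /identify exchange_big.
by apply: eq_bigr => x _; apply: eq_bigr => y _.
Qed.

Lemma identify_laplacian (V : finType) (A : pred V) (c : V -> V -> R)
    (h : option V -> R) (i : option V) :
  \sum_j identify A c i j * (h i - h j) =
  \sum_(x | identify_node A x == i) \sum_y c x y *
    (h (identify_node A x) - h (identify_node A y)).
Proof.
rewrite /identify; under eq_bigr do rewrite mulr_suml.
rewrite exchange_big; apply: eq_bigr => x /eqP ->.
rewrite [RHS](partition_big (identify_node A) xpredT) //=.
by apply: eq_bigr => j _; rewrite mulr_suml; apply: eq_bigr => y /eqP ->.
Qed.

Lemma sum_laplacian (V : finType) (c : V -> V -> R) (h : V -> R) :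
  (forall x y, c x y = c y x) -> \sum_x \sum_y c x y * (h x - h y) = 0.
Proof.
move=> cC; set S := LHS.
suff : S = - S by lra.
rewrite {1}/S exchange_big -sumrN; apply: eq_bigr => x _; rewrite -sumrN.
by apply: eq_bigr => y _; rewrite cC; ring.
Qed.

Section Tree.
Variables (V : finType) (e : rel V) (root : V).
Hypothesis T_tree : is_tree e.
Local Notation child := (child e root).
Local Notation leaf := (leaf e root).
Local Notation parent := (parent e root).
Local Notation gamma := (branch_conductance e root R).
Local Notation C := (subtree_conductance e root R).

(** A voltage divider: in series with its subtree, the unit edge above [v] takes the fraction
    [gamma v] of the voltage. The factor [(C root)^-1] normalizes the current to 1. *)
Definition potential (v : V) : R :=
  (C root)^-1 * \prod_(i < distance e root v) (1 - gamma (iter i parent v)).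

Lemma potential_root : potential root = (C root)^-1.
Proof. by rewrite /potential distance_root // big_ord0 mulr1. Qed.

Lemma potential_child u v : child u v -> potential v = potential u * (1 - gamma v).
Proof.
move=> uv; have /andP[_ /eqP dv] := uv.
rewrite /potential dv big_ord_recl /= [(1 - _) * _]mulrC mulrA; do 2!congr (_ * _).
by apply: eq_bigr => i _; rewrite add0n -iterS iterSr (parentE T_tree uv).
Qed.

Lemma potential_leaf v : v != root -> leaf v -> potential v = 0.
Proof.
move=> vr lv; rewrite (potential_child (child_parent T_tree vr)).
by rewrite branch_conductanceE // lv subrr mulr0.
Qed.

Lemma sum_neighbours (F : V -> R) v :
  \sum_u (e v u)%:R * F u =
  \sum_(c | child v c) F c + (v != root)%:R * F (parent v).
Proof.
have -> : \sum_u (e v u)%:R * F u =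
    \sum_u (child v u)%:R * F u + \sum_u (child u v)%:R * F u.
  rewrite -big_split; apply: eq_bigr => u _ /=; rewrite -mulrDl -natrD; congr (_%:R * _).
  rewrite (edgeE root T_tree); case vu : (child v u); case uv : (child u v) => //.
  by have := child_asym vu; rewrite uv.
congr (_ + _).
  by rewrite [RHS]big_mkcond; apply: eq_bigr => u _; case: ifP; rewrite ?mul1r ?mul0r.
rewrite -[F (parent v)]sum_indicator_mul mulr_sumr; apply: eq_bigr => u _.
by rewrite mulrA -natrM mulnb (childE root T_tree).
Qed.

Lemma potential_harmonic v : ~~ leaf root -> ~~ leaf v ->
  \sum_u (e v u)%:R * (potential v - potential u) = (v == root)%:R.
Proof.
move=> lr lv; rewrite (sum_neighbours (fun u => potential v - potential u)).
have -> : \sum_(c | child v c) (potential v - potential c) = potential v * C v.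
  rewrite /subtree_conductance mulr_sumr; apply: eq_bigr => c vc.
  by rewrite (potential_child vc); ring.
have [->|vr] := eqVneq v root.
  by rewrite potential_root mul0r addr0 mulVf // gt_eqF // subtree_conductance_gt0.
(* Since [gamma = C / (1 + C)], also [(1 - gamma) * C = gamma]: the current into the children equals
   the one from the parent. *)
rewrite (potential_child (child_parent T_tree vr)) branch_conductanceE // (negPf lv).
have C0 := subtree_conductance_ge0 e root R v.
by rewrite /= mul1r mulr0n; field; rewrite gt_eqF // ltr_pwDl.
Qed.

(** The source is merged with the sink, so any admissible difference is 0, as is the default of
    [xget]. *)
Lemma tree_resistance_leaf : leaf root -> tree_resistance R e root = 0.
Proof.
move=> lr; rewrite /tree_resistance /identify_node lr /effective_resistance.
by case: xgetP => // r _ [h _ ->]; rewrite subrr.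
Qed.

Lemma tree_resistanceE : ~~ leaf root -> tree_resistance R e root = (C root)^-1.
Proof.
move=> lr; have [esym _ _ _] := T_tree.
have rootE : identify_node leaf root = Some root by rewrite /identify_node (negPf lr).
pose h (i : option V) := if i is Some v then potential v else 0.
have hE v : h (identify_node leaf v) = potential v.
  rewrite /identify_node; case: ifP => //= lv; rewrite potential_leaf //.
  by apply: contraNneq lr => E; rewrite -{2}E.
have c_sym x y : (e x y)%:R = (e y x)%:R :> R by rewrite esym.
rewrite /tree_resistance (@effective_resistance_eq _ _ _ _ h).
- by rewrite hE potential_root subr0.
- exact: (identify_sym _ c_sym).
move=> i; rewrite identify_laplacian rootE.
pose L v := \sum_u (e v u)%:R * (potential v - potential u).
have -> : \sum_(x | identify_node leaf x == i) \sum_y (e x y)%:R *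
   (h (identify_node leaf x) - h (identify_node leaf y)) =
   \sum_(x | identify_node leaf x == i) L x.
  by apply: eq_bigr => x _; apply: eq_bigr => y _; rewrite !hE.
case: i => [v|].
  (* Each merged leaf leaves behind an isolated node [Some v] with an empty fibre. *)
  rewrite subr0; have [lv|lv] := boolP (leaf v).
    rewrite big_pred0 => [|x]; last first.
      rewrite /identify_node; case: ifP => // lx; apply/eqP => -[E].
      by rewrite E lv in lx.
    by case: eqP => // -[E]; move: lr; rewrite -{2}E lv.
  rewrite (big_pred1 v) => [|x]; first by rewrite /L potential_harmonic.
  rewrite /identify_node /=; case: ifP => lx.
    by case: (x =P v) => // E; rewrite -E lx in lv.
  by [].
(* The law at the sink follows from the others: the total current vanishes, and among the inner
   vertices only the root contributes. *)
rewrite eqxx sub0r.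
have : \sum_x L x = 0 by exact: (sum_laplacian potential c_sym).
rewrite (bigID leaf) /= [X in _ + X](bigD1 root) //= [L root]potential_harmonic // eqxx.
rewrite [X in _ + (1 + X)]big1 => [|v /andP[lv /negPf vr]]; last first.
  by rewrite /L potential_harmonic // vr.
rewrite addr0 => /eqP; rewrite addr_eq0 => /eqP <-.
by apply: eq_bigl => v; rewrite /identify_node; case: ifP.
Qed.

End Tree.
End Network.

(** * Elimination of vertices *)

Section BoundedHeights.
Variables (R : realType) (M B : nat).

(** Heights in [[-B, B]] are coded by ordinals so that configurations form a finite type. *)
Definition height (i : 'I_(2 * B + 1)) : int := i%:Z - B%:Z.

Lemma height_inj : injective height.
Proof. by move=> i j; rewrite /height => E; apply: val_inj => /=; lia. Qed.

Lemma absz_height i : (`|height i| <= B)%N.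
Proof. by rewrite /height; have := ltn_ord i; lia. Qed.

Lemma heightP (x : int) : (`|x| <= B)%N -> {i | height i = x}.
Proof.
move=> xB; have lt : (`|(x + B%:Z)%R| < 2 * B + 1)%N by lia.
by exists (Ordinal lt); rewrite /height /=; lia.
Qed.

Definition height0 : 'I_(2 * B + 1) := sval (@heightP 0 isT).

Lemma sum_height_box (f : int -> R) (x : int) :
  (forall y, (B < `|y|)%N -> f y = 0) ->
  \sum_i (`|x - height i| <= M%:Z)%R%:R * f (height i) = box M f x.
Proof.
move=> fB; rewrite /box.
have fE y : f y = \sum_i (height i == y)%:R * f (height i).
  have [/heightP[j jy]|/fB] := leqP `|y| B.
    rewrite (bigD1 j) //= jy eqxx mul1r big1 ?addr0 // => i ij.
    by rewrite -jy (inj_eq height_inj) (negPf ij) mul0r.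
  move=> f0; rewrite big1 // => i _; case: eqP => [->|_]; last by rewrite mul0r.
  by rewrite f0 mulr0.
under [RHS]eq_bigr do rewrite fE.
rewrite exchange_big; apply: eq_bigr => i _ /=; rewrite -mulr_suml; congr (_ * _).
have [xi|xi] := boolP (`|x - height i| <= M%:Z).
  have lt : (`|(height i - x + M%:Z)%R| < 2 * M + 1)%N by lia.
  rewrite (bigD1 (Ordinal lt)) //= big1 => [|j jn].
    by rewrite addr0; case: eqP => //; lia.
  case: eqP => // E; case/eqP: jn; apply: val_inj => /=; lia.
rewrite big1 // => j _; case: eqP => // E; case/negP: xi; have := ltn_ord j; lia.
Qed.

End BoundedHeights.
Arguments height {B}.

Section Update.
Variables (V J : finType) (v : V) (j0 : J).

Definition update (f : {ffun V -> J}) (j : J) : {ffun V -> J} :=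
  [ffun w => if w == v then j else f w].

(** Fubini at [v]: a configuration is its value at [v] together with its copy reset to [j0]
    there. *)
Lemma sum_update (R : realType) (P : pred {ffun V -> J}) (G : {ffun V -> J} -> R) :
  \sum_(f | P f) G f =
  \sum_(f : {ffun V -> J} | f v == j0) \sum_(j | P (update f j)) G (update f j).
Proof.
rewrite pair_big_dep /=.
rewrite (reindex_onto (fun p : {ffun V -> J} * J => update p.1 p.2)
   (fun f => (update f j0, f v))) /=; last first.
  by move=> f _; apply/ffunP => w; rewrite !ffunE; case: eqP => [->|].
apply: eq_bigl => -[f j] /=; rewrite andbC; congr (_ && _).
rewrite xpair_eqE [update f j v]ffunE !eqxx andbT; apply/eqP/eqP => [<-|fv].
  by rewrite !ffunE eqxx.
by apply/ffunP => w; rewrite !ffunE; case: eqP => [->|].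
Qed.

End Update.

Section Elimination.
Variables (R : realType) (V : finType) (e : rel V) (root : V) (M B : nat).
Hypotheses (T_tree : is_tree e) (M_gt0 : (0 < M)%N).
Local Notation dist := (distance e root).
Local Notation child := (child e root).
Local Notation leaf := (leaf e root).
Local Notation parent := (parent e root).
Local Notation gamma := (branch_conductance e root R).
Local Notation C := (subtree_conductance e root R).
Local Notation config := {ffun V -> 'I_(2 * B + 1)}.
Implicit Types (S : {set V}) (m : V -> int -> R).

Definition edge_weight (f : config) (v : V) : R :=
  (`|height (f v) - height (f (parent v))| <= M%:Z)%R%:R.

(** Vertices outside [S] are frozen at height 0, so one configuration type serves all stages of the
    elimination; [m v] carries the weight of [v] and of its descendants already summed out. *)
Definition root_marginal S m (x : int) : R :=
  \sum_(f : config | [forall v, (v \notin S) ==> (f v == height0 B)] &&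
      (height (f root) == x))
    (\prod_(v in S | v != root) edge_weight f v) * \prod_(v in S) m v (height (f v)).

Definition absorb v m : V -> int -> R :=
  fun u x => if u == parent v then m u x * box M (m v) x else m u x.

Lemma parent_neq v : v != root -> parent v != v.
Proof.
move=> /(child_parent T_tree)/andP[_ /eqP d]; apply/eqP => E.
by move: d; rewrite E; lia.
Qed.

(** With no child left in [S], [v] enters only its own weight and the edge to its parent, so summing
    over its height first gives a box sum of [m v]. *)
Lemma root_marginal_absorb S m v x : v \in S -> v != root -> parent v \in S ->
  (forall u, u \in S -> u != root -> parent u != v) ->
  (forall y, (B < `|y|)%N -> m v y = 0) ->
  root_marginal S m x = root_marginal (S :\ v) (absorb v m) x.
Proof.
move=> vS vr pS childless mB.
rewrite /root_marginal (sum_update v (height0 B)).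
rewrite [RHS](bigID (fun f : config => f v == height0 B)) /=.
rewrite [X in _ + X]big1 ?addr0 => [|f]; last first.
  by case/andP=> /andP[/forallP/(_ v)]; rewrite in_setD1 eqxx /= => ->.
rewrite [RHS](eq_bigl (fun f : config => (f v == height0 B) &&
    ([forall v0, (v0 \notin S :\ v) ==> (f v0 == height0 B)] && (height (f root) == x))));
  last by move=> f; rewrite andbC.
rewrite big_mkcondr /=; apply: eq_bigr => f /eqP fv.
have condE j : [forall u, (u \notin S) ==> (update v f j u == height0 B)] &&
     (height (update v f j root) == x) =
   [forall u, (u \notin S :\ v) ==> (f u == height0 B)] && (height (f root) == x).
  rewrite ffunE [root == v]eq_sym (negPf vr); congr (_ && _); apply: eq_forallb => u.
  rewrite in_setD1 ffunE; have [->|uv] := eqVneq u v; first by rewrite vS fv eqxx implybT.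
  by [].
rewrite (eq_bigl _ _ condE); case: ifP => cond; last by rewrite big_pred0.
pose E := \prod_(u in S :\ v | u != root) edge_weight f u.
pose W := \prod_(u in S :\ v) m u (height (f u)).
transitivity (\sum_(j < 2 * B + 1)
    (`|height (f (parent v)) - height j| <= M%:Z)%R%:R * m v (height j) * (E * W)).
  apply: eq_bigr => j _.
  have updN u : u != v -> update v f j u = f u by rewrite ffunE => /negPf ->.
  rewrite (bigD1 v) ?vS //= [X in _ * X](bigD1 v) //=.
  rewrite {1}/edge_weight (updN (parent v)) ?parent_neq // ffunE eqxx distrC.
  have -> : \prod_(i | (i \in S) && (i != root) && (i != v)) edge_weight (update v f j) i = E.
    apply: eq_big => [u|u].
      by rewrite in_setD1; case: (u == v); case: (u == root); rewrite ?andbF ?andbT.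
    by case/andP=> /andP[uS ur] uv; rewrite /edge_weight !updN // childless.
  have -> : \prod_(i in S | i != v) m i (height (update v f j i)) = W.
    apply: eq_big => [u|u]; first by rewrite in_setD1 andbC.
    by case/andP=> _ uv; rewrite updN.
  by ring.
rewrite -mulr_suml sum_height_box // mulrCA; congr (_ * _).
have pSv : parent v \in S :\ v by rewrite in_setD1 parent_neq.
rewrite /W (bigD1 (parent v)) //= [RHS](bigD1 (parent v)) //= /absorb eqxx.
rewrite mulrCA mulrA; congr (_ * _).
by apply: eq_bigr => u /andP[_ /negPf ->].
Qed.

Lemma root_marginal1 m x : (forall y, (B < `|y|)%N -> m root y = 0) ->
  root_marginal [set root] m x = m root x.
Proof.
move=> mB; rewrite /root_marginal.
have [/heightP[j jx]|xB] := leqP `|x| B; last first.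
  rewrite mB // big_pred0 // => f; apply/negbTE; rewrite negb_and; apply/orP; right.
  by apply: contraL xB => /eqP <-; rewrite -leqNgt absz_height.
pose f : config := [ffun w => if w == root then j else height0 B].
rewrite (big_pred1 f) => [|g].
  rewrite big_set1 [X in X * _]big1 ?mul1r => [|u]; last first.
    by rewrite inE => /andP[/eqP ->]; rewrite eqxx.
  by rewrite ffunE eqxx jx.
rewrite /= -jx (inj_eq (@height_inj B)); apply/andP/eqP => [[/forallP g0 /eqP gr]|->].
  apply/ffunP => w; rewrite ffunE; case: eqP => [->//|/eqP wr].
  by have := g0 w; rewrite inE wr => /eqP.
split; last by rewrite ffunE eqxx.
by apply/forallP => w; rewrite inE ffunE; case: eqP; rewrite ?eqxx.
Qed.

(** The invariant of the elimination: a child adds its conductance to the rate of its parent only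
    once it is absorbed. Leaves keep an exact point mass, which [decay_box_delta] needs. *)
Definition admissible S m : Prop :=
  [/\ root \in S,
      forall v, v \in S -> v != root -> parent v \in S,
      forall v, v \in S -> forall y, (B < `|y|)%N -> m v y = 0,
      forall v, v \in S -> leaf v -> forall y, m v y = (y == 0)%:R
    & forall v, v \in S -> ~~ leaf v ->
        decay M (\sum_(c | child v c && (c \notin S)) gamma c) (m v)].

Lemma admissible_absorb S m v : admissible S m -> v \in S -> v != root ->
  (forall c, child v c -> c \notin S) ->
  admissible (S :\ v) (absorb v m).
Proof.
move=> [rS pS mB mL mD] vS vr cS; have pv := child_parent T_tree vr.
have pSv := pS v vS vr.
split.
- by rewrite in_setD1 eq_sym vr.
- move=> u; rewrite !in_setD1 => /andP[uv uS] ur; rewrite pS // andbT.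
  by apply/eqP => E; have := cS u; rewrite uS -E child_parent // => /(_ isT).
- move=> u; rewrite in_setD1 => /andP[_ uS] y yB; rewrite /absorb mB // mul0r.
  by case: ifP.
- move=> u; rewrite in_setD1 => /andP[_ uS] lu y; rewrite /absorb; case: eqP => E.
    by move/forallP: lu => /(_ v); rewrite E pv.
  exact: mL.
move=> u; rewrite in_setD1 => /andP[uv uS] lu.
have [E|up] := eqVneq u (parent v); last first.
  apply: (eq_decay (f := m u)) => [y|]; first by rewrite /absorb (negPf up).
  rewrite (eq_bigl (fun c => child u c && (c \notin S))); first exact: mD.
  move=> c; rewrite in_setD1 negb_and negbK; have [->|//] := eqVneq c v.
  by rewrite vS andbT andbF (childE root T_tree) (negPf up) andbF.
apply: (eq_decay (f := fun x => m u x * box M (m v) x)) => [y|].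
  by rewrite /absorb E eqxx.
rewrite (bigD1 v) /=; last by rewrite in_setD1 eqxx /= E pv.
rewrite addrC (eq_bigl (fun c => child u c && (c \notin S))); last first.
  move=> c; rewrite in_setD1 negb_and negbK; have [->|_] := eqVneq c v.
    by rewrite vS !andbF.
  by rewrite andbT.
apply: decayM; first exact: mD.
rewrite branch_conductanceE //; case: ifP => lv.
  by apply: decay_box_delta => y; exact: mL.
(* All children of [v] have been absorbed, so its rate has reached the full value [C v]. *)
have CE : C v = \sum_(c | child v c && (c \notin S)) gamma c.
  by apply: eq_bigl => c; case vc: (child v c) => //=; rewrite cS.
apply: decay_box => //; first exact: subtree_conductance_ge0.
by rewrite CE; apply: mD => //; rewrite lv.
Qed.

Lemma decay_root_marginal S m : ~~ leaf root -> admissible S m ->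
  decay M (C root) (root_marginal S m).
Proof.
move=> lr; have [n] := ubnP #|S|; elim: n S m => // n IH S m; rewrite ltnS => Sn adm.
have [rS pS mB mL mD] := adm.
(* A vertex of [S] farthest from the root has no child in [S]; if it is the root, nothing else is
   left. *)
pose v := [arg max_(v > root | v \in S) dist v].
have [vS vmax] : v \in S /\ forall u, u \in S -> (dist u <= dist v)%N.
  by rewrite /v; case: arg_maxnP.
have [vr|vr] := eqVneq v root.
  have SE : S = [set root].
    apply/setP => u; rewrite inE; apply/idP/eqP => [/vmax|->//].
    by rewrite vr distance_root leqn0 => /eqP/(distance_eq0 T_tree).
  rewrite SE; apply: (eq_decay (f := m root)) => [x|].
    by rewrite root_marginal1 //; exact: mB.
  have := mD root rS lr; rewrite (eq_bigl (child root)) // => c.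
  case rc : (child root c) => //=.
  by rewrite SE inE (child_neq_root rc).
have cS c : child v c -> c \notin S.
  move=> /andP[_ /eqP dc]; apply/negP => /vmax; rewrite dc; lia.
apply: (eq_decay (f := root_marginal (S :\ v) (absorb v m))) => [x|].
  rewrite [RHS](root_marginal_absorb (v := v)) //; last exact: mB.
    exact: pS.
  move=> u uS ur; apply/eqP => E.
  by have := cS u; rewrite uS -E child_parent // => /(_ isT).
apply: IH; last exact: admissible_absorb.
by apply: leq_trans Sn; rewrite [leqRHS](cardsD1 v) vS.
Qed.

Definition vertex_weight (v : V) (x : int) : R :=
  (`|x| <= B)%N%:R * (leaf v ==> (x == 0))%:R.

Lemma decay_root_marginalT : ~~ leaf root ->
  decay M (C root) (root_marginal (finset.setTfor V) vertex_weight).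
Proof.
move=> lr; apply: decay_root_marginal => //; split; rewrite ?inE //.
- by move=> v _ y; rewrite ltnNge /vertex_weight => /negPf ->; rewrite mul0r.
- move=> v _ lv y; rewrite /vertex_weight lv /=; case: eqP => [->|_].
    by rewrite absz0 mulr1.
  by rewrite mulr0.
move=> v _ lv; rewrite big_pred0 => [|c]; last by rewrite finset.in_setT andbF.
apply: eq_decay (decay_indicator R M B) => x.
by rewrite /vertex_weight (negPf lv) mulr1.
Qed.

End Elimination.

(** * Laws on countable types *)

Section CountableLaw.
Variables (R : realType) (d : measure_display) (Omega : measurableType d).
Variables (P : probability Omega R) (S : countType) (X : Omega -> S).
Hypothesis mX : forall s, measurable [set o | X o = s]%classic.

(** [pickle] splits a preimage into countably many pieces, each of them empty or the fibre of a
    single value. *)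
Let fiber (D : set S) (n : nat) : set Omega :=
  [set o | D (X o) /\ pickle (X o) = n]%classic.

Let fiberE D n : fiber D n = set0 \/ exists2 s, D s & fiber D n = [set o | X o = s]%classic.
Proof.
have [[x [xD xE]]|no] := pselect (exists o, fiber D n o); last first.
  by left; apply/seteqP; split => // o fo; apply: no; exists o.
right; exists (X x) => //; apply/seteqP; split => o' /=.
  by move=> [_ yE]; apply: (pcan_inj pickleK); rewrite yE.
by move=> E; split; rewrite E.
Qed.

Let preimageE D : [set o | D (X o)]%classic = (\bigcup_n fiber D n)%classic.
Proof.
apply/seteqP; split => o; first by move=> Do; exists (pickle (X o)).
by move=> [n _ []].
Qed.

Lemma measurable_countable_preimage (D : set S) : measurable [set o | D (X o)]%classic.
Proof.
rewrite preimageE; apply: bigcup_measurable => n _.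
by have [->|[s _ ->]] := fiberE D n.
Qed.

Lemma negligible_countable_preimage (D : set S) :
  (forall s, D s -> P [set o | X o = s]%classic = 0%E) ->
  P.-negligible [set o | D (X o)]%classic.
Proof.
move=> D0; rewrite preimageE; apply: negligible_bigcup => n.
have [->|[s Ds ->]] := fiberE D n; first exact: negligible_set0.
by apply/negligibleP; [exact: mX | exact: D0].
Qed.

Lemma measurable_countable_comp (g : S -> R) :
  measurable_fun setT (EFin \o (g \o X)).
Proof.
apply/measurable_EFinP => _ Y mY; rewrite setTI.
exact: (measurable_countable_preimage (fun s => Y (g s))).
Qed.

Variables (J : finType) (emb : J -> S) (k : R) (w : S -> R).
Hypothesis emb_inj : injective emb.
Hypothesis w_supp : forall s, (forall j, s <> emb j) -> w s = 0.
Hypothesis lawX : forall s, P [set o | X o = s]%classic = (k * w s)%:E.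

(** The values outside the image of [emb] form a null event, so almost everywhere [g (X o)] is a
    finite combination of indicators. *)
Lemma integral_law (g : S -> R) :
  (\int[P]_o (g (X o))%:E = (\sum_j k * w (emb j) * g (emb j))%:E)%E.
Proof.
pose F j := [set o | X o = emb j]%classic.
pose h o := \sum_j ((g (emb j))%:E * (\1_(F j) o)%:E)%E.
have hi j : P.-integrable setT (fun o => ((g (emb j))%:E * (\1_(F j) o)%:E)%E).
  by apply: integrableZl => //; apply: integrable_indic; exact: mX.
rewrite (@ae_eq_integral _ _ _ P setT h) //.
- rewrite /h integral_sum // -sumEFin; apply: eq_bigr => j _.
  rewrite integralZl //; last by apply: integrable_indic; exact: mX.
  rewrite integral_indic //; last exact: mX.
  rewrite setIT mulrC EFinM; congr (_ * _)%E; exact: lawX.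
- exact: measurable_countable_comp.
- have /integrableP[] // := @integrable_sum _ _ _ P setT measurableT J (index_enum J)
    xpredT _ (fun j _ => hi j).
apply: negligibleS (negligible_countable_preimage (D := [set s | forall j, s <> emb j]%classic) _).
  move=> o /= nE j Ej; apply: nE => _.
  rewrite /h (bigD1 j) //= big1 => [|i ij].
    by rewrite indicE mem_set // mule1 adde0 Ej.
  rewrite indicE memNset ?mule0 // /F /= Ej => /emb_inj E.
  by rewrite E eqxx in ij.
by move=> s /= /w_supp ws; rewrite lawX ws mulr0.
Qed.

Lemma prob_law (Q : pred S) :
  P [set o | Q (X o)]%classic = (k * \sum_(j | Q (emb j)) w (emb j))%:E.
Proof.
have := integral_law (fun s => (Q s)%:R).
have -> : (fun o => ((Q (X o))%:R : R)%:E) =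
   (fun o => (\1_([set o | Q (X o)]%classic) o : R)%:E).
  apply/funext => o; rewrite indicE; congr (_%:R)%:E.
  case: (boolP (Q (X o))) => [q|/negP q]; first by rewrite mem_set.
  by rewrite memNset.
rewrite integral_indic //; last exact: (measurable_countable_preimage (fun s => Q s)).
rewrite setIT => ->; congr EFin; rewrite mulr_sumr [RHS]big_mkcond.
by apply: eq_bigr => j _; case: (Q _); rewrite ?mulr1 ?mulr0.
Qed.

Lemma law_total : k * \sum_j w (emb j) = 1.
Proof.
have := prob_law xpredT; rewrite (_ : [set o | _]%classic = setT); last by apply/seteqP.
by rewrite probability_setT => -[].
Qed.

Lemma variance_law_le (g : S -> R) :
  (variance P (fun o => g (X o)) <= (\sum_j k * w (emb j) * g (emb j) ^+ 2)%:E)%E.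
Proof.
rewrite /variance covariance.unlock expectation.unlock integral_law /=.
set c := \sum_j _.
rewrite (integral_law (fun s => (g s - c) * (g s - c))) lee_fin.
have tot := law_total; rewrite mulr_sumr in tot.
have -> : \sum_j k * w (emb j) * ((g (emb j) - c) * (g (emb j) - c)) =
   \sum_j k * w (emb j) * g (emb j) ^+ 2 - 2 * c * c + c ^+ 2 * \sum_j k * w (emb j).
  have -> : 2 * c * c = \sum_j 2 * c * (k * w (emb j) * g (emb j)) by rewrite -mulr_sumr.
  by rewrite mulr_sumr -sumrB -big_split /=; apply: eq_bigr => j _; ring.
rewrite tot mulr1; have := sqr_ge0 c; rewrite [c ^+ 2]expr2; lra.
Qed.

End CountableLaw.

(* Summing [p l * q i <= p i * q l] over [i < m <= l] gives
   [tp * (1 - tq) <= (1 - tp) * tq] for the tails [tp] and [tq]. *)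
Lemma tail_comparison (R : realDomainType) (p q : nat -> R) (m L : nat) (tq : R) :
  (forall i l, (i < m <= l)%N -> p l * q i <= p i * q l) ->
  0 <= \sum_(0 <= i < m) p i ->
  \sum_(0 <= i < m) p i + \sum_(m <= l < L) p l <= 1 ->
  0 <= tq -> \sum_(0 <= i < m) q i = 1 - tq -> \sum_(m <= l < L) q l <= tq ->
  \sum_(m <= l < L) p l <= tq.
Proof.
move=> pq p0 p1 tq0 qE qL.
set hp := \sum_(0 <= i < m) p i in p0 p1; set tp := \sum_(m <= l < L) p l in p1 *.
have H : tp * (1 - tq) <= hp * \sum_(m <= l < L) q l.
  rewrite -qE /tp /hp !big_distrlr [leRHS]exchange_big /=.
  rewrite !big_nat; apply: ler_sum => l /andP[ml _].
  rewrite !big_nat; apply: ler_sum => i /andP[_ im].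
  by rewrite pq // im ml.
nra.
Qed.

(** * Law of the absolute value of an integer variable *)

Section AbsoluteValueLaw.
Variables (R : realType) (d : measure_display) (Omega : measurableType d).
Variables (P : probability Omega R) (N : Omega -> int) (k : R) (w : int -> R).
Hypothesis mN : forall x, measurable [set o | N o = x]%classic.
Hypothesis lawN : forall x, P [set o | N o = x]%classic = (k * w x)%:E.

Definition abs_mass (i : nat) : R :=
  if i is 0%N then k * w 0 else k * w i%:Z + k * w (- i%:Z).

Let mpre (D : set int) : measurable [set o | D (N o)]%classic.
Proof. exact: measurable_countable_preimage. Qed.

Lemma prob_abs_eq (i : nat) : P [set o | `|N o|%N = i]%classic = (abs_mass i)%:E.
Proof.
case: i => [|i].
  rewrite -lawN; congr (P _); apply/seteqP; split => o /=.
    by move/eqP; rewrite absz_eq0 => /eqP.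
  by move=> ->.
have -> : [set o | `|N o|%N = i.+1]%classic =
   ([set o | N o = i.+1%:Z] `|` [set o | N o = - i.+1%:Z])%classic.
  by apply/seteqP; split => o /=; lia.
rewrite measureU //; first by rewrite /abs_mass EFinD; congr (_ + _)%E; exact: lawN.
by apply/seteqP; split => o //= -[-> ].
Qed.

Lemma prob_abs_itv (m n : nat) :
  P [set o | (m <= `|N o| < n)%N]%classic = (\sum_(m <= i < n) abs_mass i)%:E.
Proof.
elim: n => [|n IH].
  rewrite big_geq // (_ : [set o | _]%classic = set0) ?measure0 //.
  by apply/seteqP; split => o //=; rewrite andbF.
have [mn|nm] := leqP m n; last first.
  rewrite big_geq // (_ : [set o | _]%classic = set0) ?measure0 //.
  by apply/seteqP; split => o //= /andP[]; lia.
rewrite big_nat_recr //= EFinD -IH -prob_abs_eq -measureU //.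
- congr (P _); apply/seteqP; split => o /=; last by lia.
  move=> h; have [E|E] := eqVneq `|N o|%N n; first by right.
  by left; lia.
- exact: (mpre (fun x => (m <= `|x| < n)%N)).
- exact: (mpre (fun x => `|x|%N = n)).
by apply/seteqP; split => o //= -[] h E; move: h; rewrite E ltnn andbF.
Qed.

Lemma prob_abs_tail (m : nat) :
  P [set o | (m <= `|N o|)%N]%classic = (1 - \sum_(0 <= i < m) abs_mass i)%:E.
Proof.
rewrite EFinB -prob_abs_itv -probability_setC.
  by congr (P _); apply/seteqP; split => o /=; lia.
exact: (mpre (fun x => (0 <= `|x| < m)%N)).
Qed.

Lemma prob_abs_tail_ge (m L : nat) :
  ((\sum_(m <= i < L) abs_mass i)%:E <= P [set o | (m <= `|N o|)%N]%classic)%E.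
Proof.
rewrite -prob_abs_itv; apply: le_measure; rewrite ?inE.
- exact: (mpre (fun x => (m <= `|x| < L)%N)).
- exact: (mpre (fun x => (m <= `|x|)%N)).
by move=> o /= /andP[].
Qed.

End AbsoluteValueLaw.

(** * The Lipschitz functions as a finite set of configurations *)

Section LipschitzConfigurations.
Variables (R : realType) (V : finType) (e : rel V) (root : V) (M : nat).
Hypothesis T_tree : is_tree e.
Local Notation B := (M * #|V|)%N.
Local Notation config := {ffun V -> 'I_(2 * B + 1)}.
Local Notation A := (lipschitz_zero_on_leaves e root M).
Local Notation parent := (parent e root).
Local Notation leaf := (leaf e root).

Definition heights (f : config) : {ffun V -> int} := [ffun v => height (f v)].

Lemma heights_inj : injective heights.
Proof.
move=> f g /ffunP fg; apply/ffunP => v; apply: (@height_inj B).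
by have := fg v; rewrite !ffunE.
Qed.

Lemma lipschitz_parentP (h : {ffun V -> int}) : A h <->
  (forall v, v != root -> `|h v - h (parent v)| <= M%:Z) /\
  (forall v, leaf v -> h v = 0).
Proof.
have [esym _ _ _] := T_tree.
split=> -[h1 h2]; split => //.
  move=> v vr.
  by apply: h1; have /andP[] := child_parent T_tree vr; rewrite esym.
move=> u v; rewrite (edgeE root T_tree) => /orP[] c.
  by rewrite distrC -(parentE T_tree c) h1 // (child_neq_root c).
by rewrite -(parentE T_tree c) h1 // (child_neq_root c).
Qed.

(** Walk down from [v] through children to a leaf: the value changes by at most [M] per step and
    there are fewer than [#|V|] steps. *)
Lemma lipschitz_bounded (h : {ffun V -> int}) : A h -> forall v, (`|h v| <= B)%N.
Proof.
move=> [hM h0] v.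
suff H n u : (#|V| <= distance e root u + n)%N -> (`|h u| <= M * n)%N.
  by apply: H; rewrite leq_addl.
elim: n u => [|n IH] u Vn.
  by have := distance_lt root T_tree u; rewrite addn0 in Vn; rewrite ltnNge Vn.
have [/h0 -> //|/forallPn[c]] := boolP (leaf u); rewrite negbK => uc.
have /andP[euc /eqP dc] := uc.
have := hM _ _ euc; have := IH c; rewrite dc addSnnS => /(_ Vn).
by rewrite mulnS; lia.
Qed.

Lemma lipschitz_heights (s : {ffun V -> int}) :
  (forall f, s <> heights f) -> \1_A s = 0 :> R.
Proof.
move=> sn; rewrite indicE memNset // => sA.
apply: (sn [ffun v => sval (@heightP _ (s v) (lipschitz_bounded sA v))]).
by apply/ffunP => v; rewrite !ffunE; case: heightP.
Qed.

Lemma prod_natr_bool (I : finType) (Q b : pred I) :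
  \prod_(i | Q i) (b i)%:R = [forall (i | Q i), b i]%:R :> R.
Proof.
have [/forallP H|/forallPn[i]] := boolP [forall (i | Q i), b i].
  by rewrite big1 // => i Qi; have := H i; rewrite Qi /= => ->.
by rewrite negb_imply => /andP[Qi /negPf bi]; rewrite (bigD1 i) //= bi mul0r.
Qed.

(** The Lipschitz condition is one factor per vertex other than the root, for the edge to its
    parent. The cut-off in [vertex_weight] is 1 on coded heights. *)
Lemma indic_lipschitz (f : config) : \1_A (heights f) =
  (\prod_(v in finset.setTfor V | v != root) edge_weight R e root M f v) *
   \prod_(v in finset.setTfor V) vertex_weight R e root B v (height (f v)).
Proof.
rewrite (prod_natr_bool (fun v => (v \in finset.setTfor V) && (v != root))
   (fun v => (`|height (f v) - height (f (parent v))| <= M%:Z))).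
rewrite (eq_bigr (fun v => (leaf v ==> (height (f v) == 0))%:R)); last first.
  by move=> v _; rewrite /vertex_weight absz_height mul1r.
rewrite prod_natr_bool -natrM mulnb indicE; congr (_%:R); congr nat_of_bool.
apply/idP/idP.
  rewrite inE => /lipschitz_parentP[h1 h2]; apply/andP; split; apply/forallP => v.
    by rewrite finset.in_setT /=; apply/implyP => /h1; rewrite !ffunE.
  by rewrite finset.in_setT /=; apply/implyP => /h2; rewrite ffunE => ->.
move=> /andP[/forallP h1 /forallP h2]; rewrite inE; apply/lipschitz_parentP; split => v hv.
  by have := h1 v; rewrite finset.in_setT hv !ffunE.
by have := h2 v; rewrite finset.in_setT hv !ffunE => /eqP.
Qed.

Definition root_count (x : int) : R :=
  \sum_(f : config | height (f root) == x) \1_A (heights f).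

Lemma decay_root_count : (0 < M)%N -> ~~ leaf root ->
  decay M (subtree_conductance e root R root) root_count.
Proof.
move=> M0 lr; apply: eq_decay (decay_root_marginalT R B T_tree M0 lr) => x.
rewrite /root_marginal /root_count; apply: eq_big => f.
  by rewrite andbC; case: (_ == x) => //=; apply/forallP => v; rewrite finset.in_setT.
by move=> _; rewrite indic_lipschitz.
Qed.

Lemma sum_root_count (g : int -> R) :
  \sum_(f : config) g (height (f root)) * \1_A (heights f) =
  \sum_(i < 2 * B + 1) g (height i) * root_count (height i).
Proof.
rewrite (partition_big (fun f : config => f root) xpredT) //=.
apply: eq_bigr => i _; rewrite /root_count mulr_sumr; apply: eq_big => f.
  by rewrite (inj_eq (@height_inj B)).
by move=> /eqP ->.
Qed.

End LipschitzConfigurations.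

(** * Comparison with the discrete Gaussian *)

Section GaussianComparison.
Variables (R : realType) (M : nat) (kappa : R) (f : int -> R).
Local Notation K := (2 * M%:R + 1).
Local Notation W := (discrete_gaussian_weight (K ^+ 2 * kappa^-1)).
Hypotheses (kappa_gt0 : 0 < kappa) (f_decay : decay M kappa f).

Let K_gt0 : 0 < K :> R.
Proof. by rewrite ltr_wpDl // mulr_ge0. Qed.

Lemma gaussian_weightE (x : int) : W x = expR (- (kappa / K ^+ 2 * x%:~R ^+ 2 / 2)).
Proof.
rewrite /discrete_gaussian_weight gt_eqF; last by rewrite mulr_gt0 ?invr_gt0 ?exprn_gt0.
congr expR; rewrite mulNr; congr (- _).
by rewrite -mulrA [in RHS]mulrC -[in RHS]mulrA [in RHS]mulrC;
   field; rewrite !gt_eqF.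
Qed.

(** After the shift by [M + 1], the step from [j] to [j + 1] has exponent [lam (j + 1)] for [f],
    more than the [lam (j + 1/2)] of the Gaussian weight, so the ratio of the two is
    nonincreasing. *)
Lemma decay_gaussian (i l : nat) : (i <= l)%N ->
  f (l + M.+1)%N * W i <= f (i + M.+1)%N * W l.
Proof.
have [f0 _ fd] := f_decay.
have W0 x : 0 < W x by rewrite gaussian_weightE expR_gt0.
have step (j : nat) : f (j.+1 + M.+1)%N * W j <= f (j + M.+1)%N * W j.+1.
  have := fd (j + M.+1)%N; rewrite -addSn => h.
  apply: le_trans (ler_wpM2r (ltW (W0 _)) h) _.
  rewrite mulrAC mulrC ler_wpM2l // !gaussian_weightE -expRD ler_expR.
  rewrite addnS subSn ?leq_addl // addnK -!pmulrn -[j.+1%:R]natr1.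
  have lam0 : 0 < kappa / K ^+ 2 by rewrite divr_gt0 // exprn_gt0.
  move: (kappa / _) lam0 => lam lam0; have := ler0n R j; nra.
move/subnKC <-; elim: (l - i)%N => [|n IH]; first by rewrite addn0.
rewrite [(i + n.+1)%N]addnS -(ler_pM2r (W0 (i + n)%N)).
have := ler_wpM2r (ltW (W0 i)) (step (i + n)%N).
have := ler_wpM2r (ltW (W0 (i + n).+1)) IH.
move: (W i) (W (i + n)%N) (W (i + n).+1) => a b c.
lra.
Qed.

Lemma gaussian_weightN (x : int) : W (- x) = W x.
Proof. by rewrite !gaussian_weightE mulrNz sqrrN. Qed.

(* The mass of a Gaussian at [0] is counted once, that at [i > 0] twice. *)
Lemma decay_abs_mass (k' : R) (i l : nat) : 0 <= k' -> (i < l)%N ->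
  f (l + M.+1)%N * abs_mass k' W i <= f (i + M.+1)%N * abs_mass k' W l.
Proof.
have [f0 _ _] := f_decay.
move=> k'0 il; have h := decay_gaussian (ltnW il).
have -> : abs_mass k' W l = k' * 2 * W l.
  by case: l il {h} => // l _; rewrite /abs_mass gaussian_weightN; ring.
have le2 : abs_mass k' W i <= k' * 2 * W i.
  case: i {il h} => [|i]; last by rewrite /abs_mass gaussian_weightN; lra.
  by rewrite /abs_mass ler_wpM2r ?gaussian_weightE ?expR_ge0 // ler_peMr // ler1n.
apply: le_trans (ler_wpM2l (f0 _) le2) _.
by rewrite mulrCA [leRHS]mulrCA ler_wpM2l // mulr_ge0.
Qed.

End GaussianComparison.

(** * The law of the value at the root *)

Section LipschitzLaw.
Variables (R : realType) (V : finType) (e : rel V) (root : V) (M : nat).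
Hypotheses (T_tree : is_tree e) (M_gt0 : (0 < M)%N).
Variables (d : measure_display) (Omega : measurableType d) (P : probability Omega R).
Variables (phi : Omega -> {ffun V -> int}) (k : R).
Local Notation A := (lipschitz_zero_on_leaves e root M).
Hypothesis m_phi : forall s, measurable [set o | phi o = s]%classic.
Hypothesis law_phi : forall s, P [set o | phi o = s]%classic = (k * \1_A s)%:E.
Local Notation B := (M * #|V|)%N.
Local Notation K := (2 * M%:R + 1).
Local Notation C := (subtree_conductance e root R root).
Local Notation leaf := (leaf e root).
Local Notation count := (root_count R e root M).

Let w_supp := lipschitz_heights R root (M := M) T_tree.

Lemma prob_root (Q : pred int) : P [set o | Q (phi o root)]%classic =
  (k * \sum_(i < 2 * B + 1 | Q (height i)) count (height i))%:E.
Proof.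
rewrite (prob_law m_phi (@heights_inj _ _) w_supp law_phi (fun s => Q (s root))).
congr (k * _)%:E; rewrite big_mkcond [RHS]big_mkcond /=.
have := sum_root_count e root M (fun x => (Q x)%:R : R).
rewrite (eq_bigr (fun f => if Q (heights f root) then \1_A (heights f) else 0)).
  by move=> ->; apply: eq_bigr => i _; case: ifP => _; rewrite ?mul1r ?mul0r.
by move=> f _; rewrite ffunE; case: ifP => _; rewrite ?mul1r ?mul0r.
Qed.

Lemma root_mass_total : k * \sum_(i < 2 * B + 1) count (height i) = 1.
Proof.
have := prob_root xpredT; rewrite (_ : [set o | _]%classic = setT); last by apply/seteqP.
by rewrite probability_setT => -[].
Qed.

Lemma k_ge0 : 0 <= k.
Proof.
have := root_mass_total; have [//|k0] := leP 0 k => E.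
have : k * \sum_(i < 2 * B + 1) count (height i) <= 0.
  apply: mulr_le0_ge0; first exact: ltW.
  by apply: sumr_ge0 => i _; apply: sumr_ge0.
by rewrite E ler10.
Qed.

Lemma prob_root_tail (n : nat) : ~~ leaf root -> (0 < n)%N ->
  P [set o | (n <= `|phi o root|)%N]%classic =
  (\sum_(n <= j < B.+1) 2 * k * count j)%:E.
Proof.
move=> lr n0; have [_ cN _] := decay_root_count R T_tree M_gt0 lr.
rewrite (prob_root (fun x => n <= `|x|)%N); congr EFin.
rewrite -mulr_sumr -mulrA mulrCA; congr (k * _).
rewrite big_mkcond /= (sum_ord_shift B (fun x => if (n <= `|x|)%N then count x else 0)).
rewrite absz0 leqNgt n0 /= add0r mulr_sumr.
rewrite -(big_mkord xpredT (fun j => (if (n <= `|j.+1%:Z|)%N then count j.+1 else 0) +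
   (if (n <= `|(- j.+1%:Z)%R|)%N then count (- j.+1%:Z) else 0))).
rewrite (big_nat_widenl n 0) // [RHS]big_mkcond [in RHS]big_nat_recl //= leqn0.
rewrite (gtn_eqF n0) add0r; apply: eq_bigr => j _.
by rewrite cN; case: ifP => _; ring.
Qed.

Lemma variance_root_le : ~~ leaf root ->
  (variance P (fun o => (phi o root)%:~R) <= (4 * K ^+ 2 / C + (M%:R + 1) ^+ 2)%:E)%E.
Proof.
move=> lr; have D := decay_root_count R T_tree M_gt0 lr.
have C0 := subtree_conductance_gt0 R lr.
apply: le_trans (variance_law_le m_phi (@heights_inj _ _) w_supp law_phi
  (fun s => (s root)%:~R)) _.
have -> : \sum_(f : {ffun V -> 'I_(2 * B + 1)}) k * \1_A (heights f) * (heights f root)%:~R ^+ 2 =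
    k * \sum_(i < 2 * B + 1) (height i)%:~R ^+ 2 * count (height i).
  rewrite -(sum_root_count e root M (fun x => x%:~R ^+ 2 : R)) mulr_sumr.
  by apply: eq_bigr => f _; rewrite ffunE; ring.
have := ler_wpM2l k_ge0 (decay_second_moment B C0 D).
by rewrite mulrCA root_mass_total mulr1 lee_fin.
Qed.

Lemma dominated_root (d' : measure_display) (Omega' : measurableType d')
    (P' : probability Omega' R) (N : Omega' -> int) (m : nat) : ~~ leaf root ->
  discrete_gaussian P' N (K ^+ 2 * C^-1) ->
  (P [set o | (m + M.+1 <= `|phi o root|)%N]%classic <=
   P' [set o | (m <= `|N o|)%N]%classic)%E.
Proof.
move=> lr [mN [k' lawN]]; have D := decay_root_count R T_tree M_gt0 lr.
have C0 := subtree_conductance_gt0 R lr; have [c0 _ _] := D.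
(* The mass at 0 is [k'] times a positive weight, which forces the sign of [k']. *)
have k'0 : 0 <= k'.
  have := lawN 0; rewrite gaussian_weightE // => E.
  have : (0 <= (k' * expR (- (C / K ^+ 2 * 0%:~R ^+ 2 / 2)))%:E)%E.
    by rewrite -E; exact: measure_ge0.
  by rewrite lee_fin pmulr_lge0 ?expR_gt0.
rewrite prob_root_tail // ?addnS // -addnS big_addn.
rewrite (prob_abs_tail mN lawN) lee_fin.
set W := discrete_gaussian_weight _.
(* [p i] is the probability of [|phi root| = i + M + 1]; the factor 2 counts both signs. *)
set p := fun i : nat => 2 * k * count (i + M.+1)%N.
rewrite [leLHS](eq_bigr p) //.
have p0 i : 0 <= p i by rewrite mulr_ge0 // mulr_ge0 // k_ge0.
have tq : (0%:E <= (1 - \sum_(0 <= i < m) abs_mass k' W i)%:E)%E.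
  by rewrite -(prob_abs_tail mN lawN); exact: measure_ge0.
rewrite lee_fin in tq.
have [Lm|mL] := ltnP (B.+1 - M.+1) m; first by rewrite big_geq // ltnW.
apply: (tail_comparison (q := abs_mass k' W)) => //.
- move=> i l /andP[im ml]; rewrite /p -!mulrA ler_wpM2l // ler_wpM2l ?k_ge0 //.
  by apply: decay_abs_mass => //; exact: leq_trans im ml.
- by apply: sumr_ge0.
(* Head and tail together are the probability of [|phi root| > M]. *)
- rewrite -big_cat_nat //= -lee_fin.
  have := prob_root_tail lr (ltn0Sn M).
  rewrite -[X in \sum_(X <= _ < _) _]add0n big_addn => <-.
  apply: probability_le1.
  exact: (measurable_countable_preimage m_phi (fun s => (M < `|s root|)%N)).
- by rewrite opprB addrC subrK.
by rewrite -lee_fin -(prob_abs_tail mN lawN); exact: prob_abs_tail_ge.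
Qed.

Lemma root_leaf_eq0 (Q : pred int) : leaf root -> ~~ Q 0 ->
  P [set o | Q (phi o root)]%classic = 0%E.
Proof.
move=> lr Q0; rewrite (prob_law m_phi (@heights_inj _ _) w_supp law_phi (fun s => Q (s root))).
rewrite big1 ?mulr0 // => f Qf; rewrite indicE memNset // => -[_ h0].
by move: Q0; rewrite -(h0 _ lr) Qf.
Qed.

Lemma variance_root_leaf : leaf root ->
  (variance P (fun o => (phi o root)%:~R) <= 0)%E.
Proof.
move=> lr.
apply: le_trans (variance_law_le m_phi (@heights_inj _ _) w_supp law_phi
  (fun s => (s root)%:~R)) _.
rewrite lee_fin big1 // => f _; have [Af|nA] := pselect (A (heights f)).
  by rewrite Af.2 // expr0n mulr0.
by rewrite indicE memNset // mulr0 mul0r.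
Qed.

End LipschitzLaw.

Theorem corollary4p8 (R : realType) (V : finType) (e : rel V) (root : V)
    (T_tree : is_tree e) (T_even : even_tree e root)
    (M : nat) (M_gt0 : (0 < M)%N)
    (d : measure_display) (Omega : measurableType d) (P : probability Omega R)
    (phi : Omega -> {ffun V -> int})
    (phi_unif : uniform_on P phi (lipschitz_zero_on_leaves e root M)) :
  let r : R := tree_resistance R e root in
  (forall (d' : measure_display) (Omega' : measurableType d')
      (P' : probability Omega' R) (N : Omega' -> int),
    discrete_gaussian P' N ((2 * M%:R + 1) ^+ 2 * r) ->
    stochastically_dominated P (fun o => `|phi o root|%:~R)
      P' (fun o => M%:R + 1 + `|N o|%:~R)) /\
  (variance P (fun o => (phi o root)%:~R) <=
    ((4 * M%:R + 2) ^+ 2 * (r + 1))%:E)%E.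
Proof.
move=> r; have [m_phi [k law_phi]] := phi_unif.
have M0 := ler0n R M.
split=> [d' Omega' P' N gaussN t|]; last first.
  (* The general bound divides by the conductance at the root, which is 0 when the root is a leaf;
     in that case [phi root] is almost surely 0. *)
  have [lr|lr] := boolP (leaf e root root).
    apply: le_trans (variance_root_leaf T_tree m_phi law_phi lr) _.
    by rewrite lee_fin /r tree_resistance_leaf // mulr_ge0 ?sqr_ge0.
  apply: le_trans (variance_root_le T_tree M_gt0 m_phi law_phi lr) _.
  (* Here [4 K ^ 2 = (4 M + 2) ^ 2], and [(M + 1) ^ 2] is below it. *)
  rewrite lee_fin /r tree_resistanceE //; move: (_^-1) => c; nra.
(* For [t <= M + 1] the event on the right is certain. *)
have [tM|tM] := leP t (M%:R + 1).
  rewrite (_ : [set o | t <= M%:R + 1 + _]%classic = setT).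
    rewrite probability_setT; apply: probability_le1.
    exact: (measurable_countable_preimage m_phi (fun s => t <= `|s root|%:~R)).
  apply/seteqP; split => // o _ /=; apply: le_trans tM _.
  by rewrite lerDl -natr_absz.
have [lr|lr] := boolP (leaf e root root).
  rewrite (root_leaf_eq0 T_tree m_phi law_phi (Q := fun x => t <= `|x|%:~R)) //.
  by rewrite normr0 -ltNge; apply: le_lt_trans tM; rewrite addr_ge0.
(* [m] is the least natural number with [t <= M + 1 + m]; it turns both events into tails of
   integers. *)
pose m := `|Num.ceil (t - (M%:R + 1))|%N.
have mP (i : nat) : (t <= M%:R + 1 + i%:R) = (m <= i)%N.
  have c0 : 0 <= Num.ceil (t - (M%:R + 1)) by rewrite ceil_ge0; lra.
  rewrite -lerBlDl [i%:R]pmulrn -ceil_le_int /m; move: (Num.ceil _) c0 => c c0.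
  lia.
have -> : [set o | t <= `|phi o root|%:~R]%classic =
    [set o | (m + M.+1 <= `|phi o root|)%N]%classic.
  apply/seteqP; split => o /=; rewrite -natr_absz.
    move=> tphi; have hM : (M.+1 <= `|phi o root|)%N.
      by rewrite -(ler_nat R) -natr1; lra.
    rewrite -(subnK hM) leq_add2r -mP natr1 -natrD subnKC //.
  move=> h; have hM : (M.+1 <= `|phi o root|)%N by apply: leq_trans h; rewrite leq_addl.
  by move: h; rewrite -{1}(subnK hM) leq_add2r -mP natr1 -natrD subnKC.
have -> : [set o | t <= M%:R + 1 + `|N o|%:~R]%classic =
    [set o | (m <= `|N o|)%N]%classic.
  by apply/seteqP; split => o /=; rewrite -natr_absz mP.
apply: (dominated_root T_tree M_gt0 m_phi law_phi) => //.
by rewrite -tree_resistanceE.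
Qed.
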